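(* Let $f$ and $g$ be partial Boolean functions and let $m=\Omega(\mathrm{R}(g)^{1.1})$. Then $$\mathrm{R}(f\circ\textsc{Ind}_m\circ g)=\Omega(\mathrm{R}(f)\,\mathrm{R}(g)\log m)=\Omega(\mathrm{R}(f)\,\mathrm{R}(\textsc{Ind}_m)\,\mathrm{R}(g)).$$
   Context: A partial Boolean function on $n$ bits is a map $f:\mathrm{Dom}(f)\to\{0,1\}$ with $\mathrm{Dom}(f)\subseteq\{0,1\}^n$. In the query model an algorithm learns the input $x$ only by querying indices $i$ and receiving $x_i$. A randomized algorithm is a probability distribution over deterministic decision trees; it computes $f$ with error $\epsilon$ if on every $x\in\mathrm{Dom}(f)$ it outputs $f(x)$ with probability at least $1-\epsilon$. $\mathrm{R}(f)$ is the minimum, over randomized algorithms computing $f$ with error $1/3$, of the maximum number of queries made (over all inputs in $\mathrm{Dom}(f)$ and all decision trees in the support). For partial functions $f$ on $n$ bits and $g$ on $k$ bits, $f\circ g$ is the partial function on $nk$ bits with domain $\{(x_1,\dots,x_n): x_i\in\mathrm{Dom}(g),\ (g(x_1),\dots,g(x_n))\in\mathrm{Dom}(f)\}$ and value $f(g(x_1),\dots,g(x_n))$. The index function $\textsc{Ind}_m:\{0,1\}^m\to\{0,1\}$: let $c$ be the largest integer with $c+2^c\le m$; for $x\in\{0,1\}^m$ let $y$ be the first $c$ bits of $x$ and $z=z_0z_1\cdots z_{2^c-1}$ the next $2^c$ bits; interpreting $y$ as the binary representation of an integer in $\{0,\dots,2^c-1\}$, $\textsc{Ind}_m(x)=z_y$.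 *)

(* Defs.v *)
From mathcomp Require Import all_boot all_order all_algebra.
From mathcomp Require Import boolp reals exp.

Set Implicit Arguments.
Unset Strict Implicit.
Unset Printing Implicit Defensive.

Import Order.TTheory GRing.Theory Num.Theory.
Local Open Scope ring_scope.

(* [f x = None] means that [x] is outside the domain of [f]. *)
Definition pbfun (n : nat) := n.-tuple bool -> option bool.

(* [x] is cut into [n] consecutive blocks of [k] bits; [mxvec_index] is the
   row-major indexing of an n x k array. *)
Definition block (n k : nat) (x : (n * k).-tuple bool) (i : 'I_n) :
    k.-tuple bool :=
  [tuple tnth x (mxvec_index i j) | j < k].

Definition pbcomp (n k : nat) (f : pbfun n) (g : pbfun k) : pbfun (n * k) :=
  fun x => if [forall i : 'I_n, isSome (g (block x i))]
           then f [tuple odflt false (g (block x i)) | i < n]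
           else None.

(* Largest [c] with [c + 2 ^ c <= m], for [0 < m]; such a [c] is below [m]. *)
Definition addr_size (m : nat) : nat := (\max_(c < m | c + 2 ^ c <= m) c)%N.

(* Most significant bit first. *)
Definition bits_to_nat (s : seq bool) : nat :=
  foldl (fun (v : nat) (b : bool) => (v.*2 + b)%N) 0%N s.

(* For [m = 0], where there is no address length, the value is a dummy. *)
Definition Ind (m : nat) : pbfun m :=
  fun x => let c := addr_size m in
           Some (nth false (drop c x) (bits_to_nat (take c x))).

Arguments Ind m x : clear implicits.

Inductive dtree (n : nat) : Type :=
| Leaf of bool
| Query of 'I_n & dtree n & dtree n.
Arguments Leaf {n}.

Fixpoint dt_out (n : nat) (t : dtree n) (x : n.-tuple bool) : bool :=
  match t with
  | Leaf b => b
  | Query i t0 t1 => dt_out (if tnth x i then t1 else t0) x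
  end.

Fixpoint dt_queries (n : nat) (t : dtree n) (x : n.-tuple bool) : nat :=
  match t with
  | Leaf _ => 0
  | Query i t0 t1 => (dt_queries (if tnth x i then t1 else t0) x).+1
  end.

(* A finitely supported distribution: the tree [ra_tree j] is drawn with
   probability [ra_prob j].  Finite support loses nothing, as repeated queries
   can be pruned and there are finitely many trees without repeated queries. *)
Record ralg (R : realType) (n : nat) := RAlg {
  ra_size : nat;
  ra_prob : 'I_ra_size -> R;
  ra_tree : 'I_ra_size -> dtree n;
  ra_prob_ge0 : forall j, 0 <= ra_prob j;
  ra_prob_sum1 : \sum_j ra_prob j = 1 }.

Arguments ra_prob {R n} _ _.
Arguments ra_tree {R n} _ _.

Definition computes (R : realType) (n : nat) (A : ralg R n) (f : pbfun n)
    (eps : R) : Prop :=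
  forall (x : n.-tuple bool) (b : bool), f x = Some b ->
    1 - eps <= \sum_(j | dt_out (ra_tree A j) x == b) ra_prob A j.

Definition ra_cost (R : realType) (n : nat) (A : ralg R n) (f : pbfun n) : nat :=
  (\max_(j | (0 < ra_prob A j)%R)
    \max_(x : n.-tuple bool | isSome (f x)) dt_queries (ra_tree A j) x)%N.

(* Queries the indices in [s]; [a] records the answers read so far. *)
Fixpoint query_all (n : nat) (f : pbfun n) (s : seq 'I_n) (a : 'I_n -> bool) :
    dtree n :=
  match s with
  | [::] => Leaf (odflt false (f [tuple a i | i < n]))
  | i :: s' => Query i (query_all f s' (fun j => if j == i then false else a j))
                       (query_all f s' (fun j => if j == i then true else a j))
  end.

Lemma query_all_out (n : nat) (f : pbfun n) (s : seq 'I_n) (a : 'I_n -> bool)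
    (x : n.-tuple bool) :
  dt_out (query_all f s a) x =
  odflt false (f [tuple if i \in s then tnth x i else a i | i < n]).
Proof.
elim: s a => [|i s IHs] a //=.
transitivity (dt_out
    (query_all f s (fun j => if j == i then tnth x i else a j)) x).
  by case: (tnth x i).
rewrite IHs; congr (odflt _ (f _)); apply: eq_from_tnth => j.
rewrite !tnth_mktuple inE.
by have [->|_] := eqVneq j i; case: ifP.
Qed.

Definition rand_attains (R : realType) (n : nat) (f : pbfun n) (q : nat) : Prop :=
  exists A : ralg R n, computes A f (1 / 3) /\ ra_cost A f = q.

Lemma rand_attains_ex (R : realType) (n : nat) (f : pbfun n) :
  exists q : nat, `[< rand_attains R f q >].
Proof.
have ge0 (j : 'I_1) : 0 <= (1 : R) by exact: ler01.
have sum1 : \sum_(j < 1) (1 : R) = 1 by rewrite big_ord1.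
pose A := RAlg (fun=> query_all f (enum 'I_n) (fun=> false)) ge0 sum1.
exists (ra_cost A f); apply/asboolP; exists A; split=> // x b fx.
rewrite (eq_bigl xpredT) => [|j /=].
  by rewrite big_ord1 lerBlDr lerDl divr_ge0.
rewrite query_all_out (_ : [tuple _ | i < n] = x) ?fx ?eqxx //.
by apply: eq_from_tnth => i; rewrite tnth_mktuple mem_enum.
Qed.

Definition rand (R : realType) (n : nat) (f : pbfun n) : nat :=
  ex_minn (rand_attains_ex R f).

Definition log2 (R : realType) (x : R) : R := ln x / ln 2.

(* Main.v *)
(* Fix an error level and a distribution [mu] on which no shallow tree guesses
   [g] noticeably better than a coin.  Feeding the address blocks of
   [Ind_m o g] with independent samples of [mu], filling all cells with a fixed
   0-input and putting either a 0-input or a 1-input in the addressed cell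
   gives pairs of inputs with values 0 and 1.  A tree notices the difference
   only by querying the addressed cell.  As in Drucker's strong direct product
   theorem, unless many address blocks received [R(g)] queries each, every cell
   is addressed with posterior probability at most about 2^(-0.95 c), so by
   [m >= R(g)^1.1] a success costs [R(g) log m] queries on average.
   Simulating an algorithm for [f o Ind_m o g] on such random pairs, the outer
   input is queried only when a difference is found, which saves a factor
   [R(g) log m]. *)
Require Import Defs.
From mathcomp Require Import all_boot all_order all_algebra.
From mathcomp Require Import boolp reals exp.
From mathcomp Require Import zify ring lra.

Set Implicit Arguments.
Unset Strict Implicit.
Unset Printing Implicit Defensive.

Import Order.TTheory GRing.Theory Num.Theory.
Local Open Scope ring_scope.

(** * Decision trees: depth, truncation, sequential composition *)

Section Trees.
Variable n : nat.
Implicit Types (t : dtree n) (x : n.-tuple bool).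

(** The obstacle is that a budget of [Q] queries limits the guess of an address bit only on average:
    on rare branches a tree may learn the bit with certainty. Let [r] in [1, 2] be twice the mass
    won by the best constant guess, divided by the mass of the branch. Convexity bounds r^160 by the
    chord 1 + (2^160 - 1)(r - 1), which becomes linear in unnormalised masses; replacing the
    constant guess by the best guess with the remaining budget gives a potential that does not grow
    in expectation when the block is queried. The product over the [c] blocks starts at most at 2^c,
    since the hard distribution leaves an advantage of order 2^(-160). So branches where it reaches
    2^(160 d) times their mass carry little mass, and on the others a 160-th root bounds the
    probability of every cell. Within [Q.+1 * d] queries, [d = c / 40], at most [d] blocks exceed
    the budget. So tiny an advantage is still hard to reach, because a constant number of majority
    votes would lift it to 1/6 at a constant factor in queries. Measures stay unnormalised, so no
    branch of mass 0 has to be set apart. *)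

Fixpoint depth t : nat :=
  if t is Query _ t0 t1 then (maxn (depth t0) (depth t1)).+1 else 0%N.

Lemma dt_queries_depth t x : (dt_queries t x <= depth t)%N.
Proof.
elim: t => //= i t0 IH0 t1 IH1; rewrite ltnS leq_max.
by case: (tnth x i); rewrite ?IH0 ?IH1 ?orbT.
Qed.

(** Past [q] queries the answer is an arbitrary [false]. Combined with Markov's inequality, this
    turns a bound on the average number of queries into a bound on the depth. *)
Fixpoint dt_trunc (q : nat) t : dtree n :=
  match t, q with
  | Leaf b, _ => Leaf b
  | Query _ _ _, 0 => Leaf false
  | Query i t0 t1, q'.+1 => Query i (dt_trunc q' t0) (dt_trunc q' t1)
  end.

Lemma depth_trunc q t : (depth (dt_trunc q t) <= q)%N.
Proof.
elim: t q => [b|i t0 IH0 t1 IH1] [|q] //=.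
by rewrite ltnS geq_max IH0 IH1.
Qed.

Lemma dt_out_trunc q t x :
  (dt_queries t x <= q)%N -> dt_out (dt_trunc q t) x = dt_out t x.
Proof.
elim: t q => [b|i t0 IH0 t1 IH1] [|q] //=; rewrite ltnS.
by case: (tnth x i); [apply: IH1 | apply: IH0].
Qed.

Fixpoint dt_bind t (k : bool -> dtree n) : dtree n :=
  match t with
  | Leaf b => k b
  | Query i t0 t1 => Query i (dt_bind t0 k) (dt_bind t1 k)
  end.

Lemma dt_out_bind t k x : dt_out (dt_bind t k) x = dt_out (k (dt_out t x)) x.
Proof. by elim: t => //= i t0 IH0 t1 IH1; case: (tnth x i). Qed.

Lemma depth_bind t k q :
  (forall b, depth (k b) <= q)%N -> (depth (dt_bind t k) <= depth t + q)%N.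
Proof.
move=> kq; elim: t => [b|i t0 IH0 t1 IH1] //=.
rewrite addSn ltnS geq_max (leq_trans IH0) ?(leq_trans IH1) //.
  by rewrite leq_add2r leq_maxr.
by rewrite leq_add2r leq_maxl.
Qed.

Definition dt_maj (t1 t2 t3 : dtree n) : dtree n :=
  dt_bind t1 (fun a => dt_bind t2 (fun b => dt_bind t3 (fun c =>
    Leaf (if a then b || c else b && c)))).

End Trees.

(** * Bounded-error algorithms and amplification by majority votes *)

Section Solves.
Variable R : realType.

(** Any finite index type is allowed, so independent runs are indexed by product types; cost is
    depth, which does not refer to the domain of [f]. *)
Definition solves n (f : pbfun n) (q : nat) (eps : R) : Prop :=
  exists (I : finType) (p : I -> R) (t : I -> dtree n),
    [/\ forall i, 0 <= p i, \sum_i p i = 1, forall i, (depth (t i) <= q)%N &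
        forall x b, f x = Some b ->
          1 - eps <= \sum_i p i * (dt_out (t i) x == b)%:R].

Lemma sum_indicator (I : finType) (p : I -> R) (P : pred I) :
  \sum_i p i * (P i)%:R = \sum_(i | P i) p i.
Proof.
rewrite [RHS]big_mkcond; apply: eq_bigr => i _.
by case: (P i); rewrite ?mulr1 ?mulr0.
Qed.

Lemma solves_le n (f : pbfun n) q q' (e e' : R) :
  (q <= q')%N -> e <= e' -> solves f q e -> solves f q' e'.
Proof.
move=> qq ee [I [p [t [p0 p1 tq ok]]]]; exists I, p, t; split=> // [i|x b fx].
  exact: leq_trans (tq i) qq.
by apply: le_trans (ok x b fx); rewrite lerD2l lerN2.
Qed.

Lemma rand_le n (f : pbfun n) q : solves f q (1 / 3) -> (rand R f <= q)%N.
Proof.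
move=> [I [p [t [p0 p1 tq ok]]]].
have reE (F : I -> R) : \sum_(j < #|I|) F (enum_val j) = \sum_i F i.
  by rewrite [RHS](reindex (@enum_val I I)) //; apply: onW_bij (@enum_val_bij I).
have q0 (j : 'I_#|I|) : 0 <= p (enum_val j) by [].
have q1 : \sum_(j < #|I|) p (enum_val j) = 1 by rewrite reE.
pose A := RAlg (fun j : 'I_#|I| => t (enum_val j)) q0 q1.
have att : rand_attains R f (ra_cost A f).
  exists A; split=> // x b /ok; rewrite -sum_indicator /=.
  by rewrite (reE (fun i => p i * (dt_out (t i) x == b)%:R)).
rewrite /rand; case: ex_minnP => r _ rmin.
apply: leq_trans (rmin _ _) _; first by apply/asboolP; exact: att.
apply/bigmax_leqP => j _; apply/bigmax_leqP => x _.
exact: leq_trans (dt_queries_depth _ _) (tq _).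
Qed.

Lemma rand_alg n (f : pbfun n) :
  exists A : ralg R n, computes A f (1 / 3) /\ ra_cost A f = rand R f.
Proof. by rewrite /rand; case: ex_minnP => r /asboolP. Qed.

Lemma rand_constant n (f : pbfun n) b :
  (forall x, f x <> Some (~~ b)) -> rand R f = 0%N.
Proof.
move=> fb; apply/eqP; rewrite -leqn0; apply: rand_le.
exists unit, (fun=> 1), (fun=> Leaf b); split=> //.
  by rewrite big_const card_unit /= addr0.
move=> x b' fx; rewrite big_const card_unit /= addr0 mul1r.
have -> : b == b'.
  by apply/eqP; apply/esym; case: b b' fx fb => [] [] // fx /(_ x) /[!fx].
by rewrite mulr1n; lra.
Qed.

(** With three independent runs, success probability [a] becomes [a^2 (3 - 2a)], which increases on
    [0, 1]; so the worst case is [a = 1 - e]. *)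
Lemma solves_maj n (f : pbfun n) q (e : R) : e <= 1 ->
  solves f q e -> solves f (3 * q) (e ^+ 2 * (3 - 2 * e)).
Proof.
move=> e1 [I [p [t [p0 p1 tq ok]]]].
exists (I * (I * I))%type, (fun i => p i.1 * (p i.2.1 * p i.2.2)),
  (fun i => dt_maj (t i.1) (t i.2.1) (t i.2.2)); split.
- by move=> i; rewrite !mulr_ge0.
- transitivity (\sum_i \sum_j \sum_l p i * (p j * p l)).
    under [RHS]eq_bigr => i _ do rewrite pair_bigA.
    by rewrite pair_bigA.
  rewrite -[RHS]p1; apply: eq_bigr => i _.
  rewrite -[RHS]mulr1 -[in RHS]p1 mulr_sumr; apply: eq_bigr => j _.
  by rewrite -!mulr_sumr p1 mulr1.
- move=> i; rewrite mulSn mul2n -addnn.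
  apply: leq_trans (depth_bind _ (q := q + q) _) _; last by rewrite leq_add2r.
  move=> a; apply: leq_trans (depth_bind _ (q := q) _) _; last by rewrite leq_add2r.
  by move=> b; apply: leq_trans (depth_bind _ (q := 0) _) _; rewrite ?addn0.
move=> x b fx; have {ok fx} := ok x b fx.
(* Multilinear form of the majority: the three sums can then be evaluated one run at a time. *)
have majE a1 a2 a3 : ((if a1 then a2 || a3 else a2 && a3) == b)%:R =
    (a1 == b)%:R * (a2 == b)%:R + ((a1 == b)%:R + (a2 == b)%:R
      - 2 * (a1 == b)%:R * (a2 == b)%:R) * (a3 == b)%:R :> R.
  by case: a1 a2 a3 b => [] [] [] [] /=; ring.
set s := fun i => (dt_out (t i) x == b)%:R : R.
set a := \sum_i _ => ea.
have lin (al be : R) : \sum_i p i * (al + be * s i) = al + be * a.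
  rewrite -[al in RHS]mul1r -p1 mulr_suml mulr_sumr -big_split /=.
  by apply: eq_bigr => i _; ring.
have a1 : a <= 1.
  rewrite -p1; apply: ler_sum => i _; rewrite ler_piMr //.
  by case: (_ == _).
have -> : \sum_i p i.1 * (p i.2.1 * p i.2.2) *
    (dt_out (dt_maj (t i.1) (t i.2.1) (t i.2.2)) x == b)%:R
    = a ^+ 2 * (3 - 2 * a).
  transitivity (\sum_i p i * \sum_j p j * \sum_l p l *
      (s i * s j + (s i + s j - 2 * s i * s j) * s l)).
    under [RHS]eq_bigr => i _.
      under eq_bigr => j _ do rewrite mulr_sumr.
      rewrite pair_bigA mulr_sumr; over.
    rewrite pair_bigA; apply: eq_bigr => -[i [j l]] _ /=.
    rewrite /s /dt_maj !dt_out_bind /=.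
    rewrite majE; ring.
  transitivity (\sum_i p i * \sum_j p j * (s i * a + (s i + a - 2 * s i * a) * s j)).
    apply: eq_bigr => i _; congr (_ * _); apply: eq_bigr => j _.
    by rewrite lin; ring.
  transitivity (\sum_i p i * (a * a + (2 * a - 2 * a * a) * s i)).
    by apply: eq_bigr => i _; rewrite lin; ring.
  by rewrite lin; ring.
have -> : 1 - e ^+ 2 * (3 - 2 * e) = (1 - e) ^+ 2 * (3 - 2 * (1 - e)) by ring.
move: e1 ea; set u := 1 - e => e1 ua.
have u0 : 0 <= u by rewrite /u; lra.
have a0 : 0 <= a by lra.
rewrite -subr_ge0.
have -> : a ^+ 2 * (3 - 2 * a) - u ^+ 2 * (3 - 2 * u) =
  (a - u) * (3 * (a + u) - 2 * (a ^+ 2 + a * u + u ^+ 2)) by ring.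
rewrite mulr_ge0 ?subr_ge0 //.
have : 0 <= a * (1 - a) by rewrite mulr_ge0 ?subr_ge0.
have : 0 <= u * (1 - u) by rewrite mulr_ge0 ?subr_ge0 //; lra.
have : 0 <= (a - u) ^+ 2 by exact: sqr_ge0.
by nra.
Qed.

(** [K] depends on [dl] alone, which keeps the final constants uniform in the functions and their
    arities. *)
Lemma solves_majK (dl : R) : 0 < dl ->
  exists K : nat, forall n (f : pbfun n) q,
    solves f q (1 / 2 - dl) -> (rand R f <= 3 ^ K * q)%N.
Proof.
move=> dl0.
have step K : forall n (f : pbfun n) q (e : R), 0 <= e ->
    solves f q (1 / 2 - e) -> 1 <= e * 6 * (7 / 5) ^+ K ->
    (rand R f <= 3 ^ K * q)%N.
  elim: K => [|K IHK] n f q e e0 sol.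
    rewrite expr0 mulr1 mul1n => e6; apply: rand_le.
    by apply: solves_le sol => //; lra.
  move=> eK; case: (lerP (1 / 6) e) => e6.
    apply: rand_le; apply: solves_le sol; last lra.
    by rewrite leq_pmull ?expn_gt0.
  rewrite expnSr -mulnA.
  (* A vote turns advantage [e] into [3/2 e - 2 e^3], at least [7/5 e] while [e < 1/6]. *)
  apply: (IHK _ _ _ (7 / 5 * e)); first by lra.
    apply: solves_le (solves_maj _ sol) => //; last lra.
    have : 0 <= e * (1 / 6 - e) * (1 / 6 + e).
      by rewrite !mulr_ge0 //; lra.
    by nra.
  by move: eK; rewrite exprS => /le_trans; apply; lra.
have [K hK] : exists K : nat, 1 <= dl * 6 * (7 / 5) ^+ K.
  have [K hK] : exists K : nat, 1 / (dl * 6) <= K%:R.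
    exists (Num.bound (1 / (dl * 6))); apply/ltW/archi_boundP.
    by rewrite divr_ge0 //; lra.
  have d6 : 0 < dl * 6 by lra.
  (* Since (7/5)^3 exceeds 2, the power grows at least linearly in [K]. *)
  exists (K * 3)%N; rewrite mulrC -ler_pdivrMr //; apply: le_trans hK _.
  rewrite mulnC exprM; elim: K => [|K IH]; first by rewrite expr0.
  rewrite exprS -natr1.
  have : 1 <= ((7 / 5) ^+ 3 : R) ^+ K.
    by apply: exprn_ege1; rewrite !exprS expr0; lra.
  move: IH; set z := (_ ^+ K); set w := (7 / 5) ^+ 3.
  have : 2 <= w :> R by rewrite /w !exprS expr0; lra.
  by nra.
by exists K => n f q sol; apply: (step K n f q dl) => //; exact: ltW.
Qed.

End Solves.

(** * Minimax: a distribution that is hard for all shallow trees *)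

Section HardDistribution.
Variable R : realType.

(* Blackwell approachability: playing against the negative part of the
   cumulated payoff increases its squared norm by at most #|S| per round. *)
Lemma approachability (S : finType) (St : Type) (pay : St -> S -> R) :
  (forall st x, `|pay st x| <= 1) ->
  (forall nu : S -> R, (forall x, 0 <= nu x) ->
    exists st, 0 <= \sum_x nu x * pay st x) ->
  forall N : nat, exists s : 'I_N -> St,
    \sum_x (Num.max 0 (- \sum_j pay (s j) x)) ^+ 2 <= N%:R * #|S|%:R.
Proof.
move=> pay1 resp; elim=> [|N [s hs]].
  have [st _] := resp (fun=> 0) (fun=> lexx 0).
  exists (fun=> st); rewrite mul0r big1 // => x _.
  by rewrite big_ord0 oppr0 maxxx expr0n.
set y := fun x => \sum_j pay (s j) x in hs.
have [st hst] := resp (fun x => Num.max 0 (- y x)) (fun x => ltac:(by rewrite le_max lexx)).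
exists (fun j => if unlift ord_max j is Some j' then s j' else st).
have -> : \sum_x (Num.max 0 (- \sum_j pay (if unlift ord_max j is Some j'
      then s j' else st) x)) ^+ 2 =
    \sum_x (Num.max 0 (- (y x + pay st x))) ^+ 2.
  apply: eq_bigr => x _; rewrite big_ord_recr /= unlift_none.
  congr (Num.max 0 (- (_ + _)) ^+ 2); apply: eq_bigr => j _.
  have -> : widen_ord (leqnSn N) j = lift ord_max j.
    by apply: val_inj; rewrite /= /bump leqNgt ltn_ord.
  by rewrite liftK.
apply: (@le_trans _ _ (\sum_x ((Num.max 0 (- y x)) ^+ 2
    - 2 * (Num.max 0 (- y x) * pay st x) + 1))).
  apply: ler_sum => x _; move: (pay1 st x); rewrite ler_norml => /andP[].
  set a := y x; set b := pay st x => b1 b2.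
  have hb : b ^+ 2 <= 1 by nra.
  have [h|h] := lerP 0 (- a); have [h'|h'] := lerP 0 (- (a + b)); nra.
rewrite !big_split /= -[N.+1%:R]natr1 mulrDl mul1r.
have -> : \sum_(x : S) 1 = #|S|%:R :> R by rewrite sumr_const.
rewrite lerD2r sumrN -mulr_sumr.
by move: hst hs; lra.
Qed.

Definition dom_value k (g : pbfun k) (x : {x | isSome (g x)}) : bool :=
  odflt false (g (val x)).

Lemma dom_valueE k (g : pbfun k) (x : {x | isSome (g x)}) :
  g (val x) = Some (dom_value x).
Proof. by rewrite /dom_value; case: x => x /=; case: (g x). Qed.

Lemma hard_distribution k (g : pbfun k) (Q : nat) (dl : R) :
  0 < dl <= 1 / 8 -> ~ solves g Q (1 / 2 - dl) ->
  exists mu : {x | isSome (g x)} -> R,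
    [/\ forall x, 0 <= mu x, \sum_x mu x = 1 &
        forall t : dtree k, (depth t <= Q)%N ->
          \sum_x mu x * (dt_out t (val x) == dom_value x)%:R
            <= 1 / 2 + 2 * dl].
Proof.
move=> /andP[dl0 dl8] nsol; apply: contrapT => nmu; apply: nsol.
pose S : finType := {x | isSome (g x)}.
pose St := {t : dtree k | (depth t <= Q)%N}.
pose pay (st : St) (x : S) : R :=
  (dt_out (val st) (val x) == dom_value x)%:R - (1 / 2 + 2 * dl).
have pay1 st x : `|pay st x| <= 1.
  by rewrite /pay ler_norml; case: (_ == _) => /=; lra.
have resp (nu : S -> R) : (forall x, 0 <= nu x) ->
    exists st, 0 <= \sum_x nu x * pay st x.
  move=> nu0; apply: contrapT => nst; apply: nmu.
  have Z0 : 0 <= \sum_x nu x by apply: sumr_ge0.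
  have ltst st : \sum_x nu x * pay st x < 0.
    by rewrite ltNge; apply/negP => h; apply: nst; exists st.
  have Zp : 0 < \sum_x nu x.
    rewrite lt_neqAle Z0 andbT eq_sym; apply/eqP => /psumr_eq0P nuz.
    have := ltst (exist _ (Leaf false) (leq0n Q)).
    by rewrite big1 ?ltxx // => x _; rewrite nuz ?mul0r.
  exists (fun x => nu x / \sum_x nu x); split.
  - by move=> x; rewrite divr_ge0.
  - by rewrite -mulr_suml divff ?gt_eqF.
  move=> t tQ; have := ltst (exist _ t tQ).
  under eq_bigr => x _ do rewrite mulrBr.
  rewrite sumrB -mulr_suml subr_lt0 => h.
  under eq_bigr => x _ do rewrite mulrAC.
  by rewrite -mulr_suml ler_pdivrMr // ltW // mulrC.
(* After [N] rounds the shortfall at one input is at most the square root of [N * #|S|]; this [N]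
   makes it smaller than [N * dl], the gap between [2 dl] and [dl]. *)
pose N := (Num.bound (#|S|%:R / dl ^+ 2)).+1.
have [s hs] := approachability pay1 resp N.
have N0 : 0 < N%:R :> R by rewrite ltr0n.
exists 'I_N, (fun=> N%:R^-1), (fun j => val (s j)); split.
- by move=> _; rewrite invr_ge0 ltW.
- by rewrite sumr_const card_ord -[_ *+ _]mulr_natl divff ?gt_eqF.
- by move=> j; case: (s j).
move=> x b gx.
have xd : isSome (g x) by rewrite gx.
pose x' : S := exist _ x xd.
have vx : dom_value x' = b by rewrite /dom_value /= gx.
rewrite -mulr_sumr ler_pdivlMl //.
rewrite leNgt; apply/negP => lt.
have hx : N%:R * dl < Num.max 0 (- \sum_j pay (s j) x').
  rewrite lt_max; apply/orP; right.
  rewrite /pay sumrB sumr_const card_ord -[_ *+ N]mulr_natl vx /=.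
  by move: lt; nra.
have : (N%:R * dl) ^+ 2 < N%:R * #|S|%:R.
  apply: lt_le_trans hs; rewrite (bigD1 x') //=.
  apply: ltr_wpDr; first by apply: sumr_ge0 => ? _; apply: sqr_ge0.
  by rewrite ltr_pXn2r // nnegrE ?mulr_ge0 ?(ltW dl0) ?le_max ?lexx ?(ltW N0).
rewrite exprMn [N%:R ^+ 2]expr2 -mulrA ltr_pM2l // -ltr_pdivlMr ?exprn_gt0 //.
move=> h; have : #|S|%:R / dl ^+ 2 < N%:R.
  apply: lt_trans (_ : (Num.bound (#|S|%:R / dl ^+ 2))%:R < _).
    by apply: archi_boundP; rewrite divr_ge0 // sqr_ge0.
  by rewrite ltr_nat.
by move/(lt_trans h); rewrite ltxx.
Qed.

End HardDistribution.

(** * Runs of a tree on a pair of inputs, up to their first difference *)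

Section Sabotage.
Variable N : nat.
Implicit Types (t : dtree N) (X Y : N.-tuple bool).

(* The run of [t] on [X] (equivalently on [Y]), stopped at the first queried
   position where [X] and [Y] differ. *)
Fixpoint sab_found t X Y : bool :=
  if t is Query j t0 t1 then
    if tnth X j != tnth Y j then true
    else sab_found (if tnth X j then t1 else t0) X Y
  else false.

Fixpoint sab_cost t X Y : nat :=
  if t is Query j t0 t1 then
    (if tnth X j != tnth Y j then 0%N
     else sab_cost (if tnth X j then t1 else t0) X Y).+1
  else 0%N.

Lemma sab_found_le_cost t X Y : (sab_found t X Y <= sab_cost t X Y)%N.
Proof.
elim: t => //= j t0 IH0 t1 IH1; case: ifP => // _.
by apply: leq_trans (leqnSn _); case: (tnth X j).
Qed.

End Sabotage.

Definition block_pos n N (e : 'I_(n * N)) : 'I_n * 'I_N :=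
  enum_val (cast_ord (esym (mxvec_cast n N)) e).

Lemma block_posK n N (e : 'I_(n * N)) :
  mxvec_index (block_pos e).1 (block_pos e).2 = e.
Proof. by rewrite /mxvec_index -surjective_pairing enum_valK cast_ordKV. Qed.

Lemma mxvec_indexK n N (i : 'I_n) (j : 'I_N) :
  block_pos (mxvec_index i j) = (i, j).
Proof. by rewrite /block_pos /mxvec_index cast_ordK enum_rankK. Qed.

Lemma tnth_block n N (x : (n * N).-tuple bool) e :
  tnth (block x (block_pos e).1) (block_pos e).2 = tnth x e.
Proof. by rewrite tnth_mktuple block_posK. Qed.

(** * Simulating a tree for the composition on given pairs of inner inputs *)

Section Simulation.
Variables (n N : nat) (X Y : 'I_n -> N.-tuple bool).
Implicit Types (t : dtree (n * N)) (w : n.-tuple bool).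
Implicit Types (x : (n * N).-tuple bool) (a : 'I_n -> option bool).

Definition sab_input w : (n * N).-tuple bool :=
  [tuple let: (i, j) := block_pos e in
         tnth (if tnth w i then Y i else X i) j | e < n * N].

Lemma block_sab_input w i :
  block (sab_input w) i = if tnth w i then Y i else X i.
Proof.
by apply: eq_from_tnth => j; rewrite !tnth_mktuple mxvec_indexK.
Qed.

Fixpoint restrict_tree i t x : dtree N :=
  match t with
  | Leaf b => Leaf b
  | Query e t0 t1 =>
    if (block_pos e).1 == i
    then Query (block_pos e).2 (restrict_tree i t0 x) (restrict_tree i t1 x)
    else restrict_tree i (if tnth x e then t1 else t0) x
  end.

(** Block [i] of [x] is never consulted. Hence the pair of block [i] can be resampled while the tree
    facing it stays fixed. *)
Lemma restrict_tree_ext i t x x' :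
  (forall i', i' != i -> block x i' = block x' i') ->
  restrict_tree i t x = restrict_tree i t x'.
Proof.
move=> xx'; elim: t => //= e t0 IH0 t1 IH1; case: eqP => [_|/eqP ne].
  by rewrite IH0 IH1.
by rewrite -tnth_block xx' // tnth_block; case: ifP.
Qed.

(* [a] remembers the bits of the input that are already known. *)
Fixpoint simulate t a : dtree n :=
  match t with
  | Leaf b => Leaf b
  | Query e t0 t1 =>
    let: (i, j) := block_pos e in
    if a i is Some b then
      simulate (if tnth (if b then Y i else X i) j then t1 else t0) a
    else if tnth (X i) j == tnth (Y i) j then
      simulate (if tnth (X i) j then t1 else t0) a
    else
      Query i
        (simulate (if tnth (X i) j then t1 else t0)
           (fun i' => if i' == i then Some false else a i'))
        (simulate (if tnth (Y i) j then t1 else t0)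
           (fun i' => if i' == i then Some true else a i'))
  end.

Definition known a w := forall i b, a i = Some b -> tnth w i = b.

Lemma known_update a w i : known a w ->
  known (fun i' => if i' == i then Some (tnth w i) else a i') w.
Proof. by move=> aw i' b; case: eqP => [-> [] | _ /aw]. Qed.

Lemma simulate_out t a w : known a w ->
  dt_out (simulate t a) w = dt_out t (sab_input w).
Proof.
elim: t a => [//|e t0 IH0 t1 IH1] a aw.
have IH (b : bool) a' : known a' w ->
    dt_out (simulate (if b then t1 else t0) a') w =
    dt_out (if b then t1 else t0) (sab_input w).
  by case: b; [apply: IH1 | apply: IH0].
rewrite /= tnth_mktuple; case: (block_pos e) => i j.
case E: (a i) => [b|]; first by rewrite IH // (aw _ _ E).
case: eqP => [XY|_] /=; first by rewrite IH //; case: (tnth w i); rewrite ?XY.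
have := @known_update a w i aw.
by case: (tnth w i) => aw'; rewrite IH.
Qed.

(** Outer bit [i] is queried at most once, at the first query that separates [X i] from [Y i].
    Before that both give the same answers, so the run within block [i] is the one followed by
    [sab_found]. *)
Lemma simulate_queries t a w : known a w ->
  (dt_queries (simulate t a) w <=
    \sum_i (a i == None) &&
      sab_found (restrict_tree i t (sab_input w)) (X i) (Y i))%N.
Proof.
elim: t a => [//|e t0 IH0 t1 IH1] a aw.
have IH (b : bool) a' : known a' w ->
    (dt_queries (simulate (if b then t1 else t0) a') w <=
    \sum_i (a' i == None) && sab_found
      (restrict_tree i (if b then t1 else t0) (sab_input w)) (X i) (Y i))%N.
  by case: b; [apply: IH1 | apply: IH0].
have tE : tnth (sab_input w) e = let: (i, j) := block_pos e in
    tnth (if tnth w i then Y i else X i) j by rewrite tnth_mktuple.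
rewrite /=; case: (block_pos e) tE => i j /= tE.
case E: (a i) => [b|].
  rewrite -(aw _ _ E) -tE; apply: leq_trans (IH _ _ aw) _.
  apply: leq_sum => i' _; have [<-|_] := eqVneq i i'; first by rewrite E.
  by case: ifP.
case: eqP => [XY|XY] /=.
  have tX : tnth (sab_input w) e = tnth (X i) j by rewrite tE; case: ifP.
  rewrite -tX; apply: leq_trans (IH _ _ aw) _.
  apply: leq_sum => i' _; have [<-|_] := eqVneq i i'; last by case: ifP.
  by rewrite /= XY eqxx /= -XY -tX; case: ifP.
have aw' := @known_update a w i aw.
rewrite (bigD1 i) //= E !eqxx /= (introF eqP XY) /= add1n ltnS.
have -> : dt_queries (if tnth w i then
      simulate (if tnth (Y i) j then t1 else t0)
           (fun i' => if i' == i then Some true else a i')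
    else simulate (if tnth (X i) j then t1 else t0)
           (fun i' => if i' == i then Some false else a i')) w =
    dt_queries (simulate (if tnth (sab_input w) e then t1 else t0)
      (fun i' => if i' == i then Some (tnth w i) else a i')) w.
  by rewrite tE; case: (tnth w i).
apply: leq_trans (IH _ _ aw') _.
rewrite (bigD1 i) //= eqxx /= add0n.
apply: leq_sum => i' ne; rewrite (negbTE ne) [i == _]eq_sym (negbTE ne).
by case: ifP.
Qed.

(** Each query of [t] is charged to its own block only, and a block is no longer charged once its
    difference has been found. *)
Lemma sab_cost_restrict t w :
  (\sum_i sab_cost (restrict_tree i t (sab_input w)) (X i) (Y i)
    <= dt_queries t (sab_input w))%N.
Proof.
elim: t => [b|e t0 IH0 t1 IH1]; first by rewrite /= big1.
set x := sab_input w in IH0 IH1 *; rewrite /=.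
have IH : (\sum_i sab_cost (restrict_tree i (if tnth x e then t1 else t0) x)
    (X i) (Y i) <= dt_queries (if tnth x e then t1 else t0) x)%N by case: ifP.
move: IH; rewrite -ltnS => /(leq_trans _); apply.
set t' := if tnth x e then t1 else t0.
have : tnth x e = let: (i, j) := block_pos e in
    tnth (if tnth w i then Y i else X i) j by rewrite tnth_mktuple.
case: (block_pos e) => i j /= tE.
rewrite (bigD1 i) //= [Z in (_ <= Z.+1)%N](bigD1 i) //= eqxx /= addSn ltnS.
apply: leq_add; last first.
  by apply: leq_sum => i' ne; rewrite eq_sym (negbTE ne).
case: eqP => //= XY.
have tX : tnth x e = tnth (X i) j by rewrite tE; case: ifP.
by rewrite /t' tX; case: ifP.
Qed.

End Simulation.

(** * Resampling one coordinate of a product distribution *)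

Section Resampling.
Variables (R : realType) (I Om : finType) (P : Om -> R).
Implicit Types om : {ffun I -> Om}.

Definition ffun_update om (i : I) (o : Om) : {ffun I -> Om} :=
  [ffun j => if j == i then o else om j].

Definition prod_weight om : R := \prod_j P (om j).

Hypothesis P1 : \sum_o P o = 1.

Lemma sum_prod_weight : \sum_om prod_weight om = 1.
Proof.
rewrite -(bigA_distr_bigA (fun=> P)) /=.
by rewrite big1 // => i _.
Qed.

Lemma resample (i : I) (F : {ffun I -> Om} -> R) :
  \sum_om prod_weight om * F om =
  \sum_om prod_weight om * \sum_o P o * F (ffun_update om i o).
Proof.
transitivity (\sum_(p : {ffun I -> Om} * Om) prod_weight p.1 * P p.2 * F p.1).
  rewrite -(pair_bigA _ (fun om o => prod_weight om * P o * F om)) /=.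
  apply: eq_bigr => om _.
  by rewrite -mulr_suml -mulr_sumr P1 mulr1.
(* Exchanging coordinate [i] with the fresh sample is an involution that preserves the product
   weight. *)
pose h (p : {ffun I -> Om} * Om) := (ffun_update p.1 i p.2, p.1 i).
have hK : involutive h.
  case=> om o; rewrite /h /=; congr (_, _); last by rewrite ffunE eqxx.
  by apply/ffunP => j; rewrite !ffunE; case: eqP => [->|].
rewrite (reindex_inj (inv_inj hK)) /=.
under [RHS]eq_bigr => om _ do rewrite mulr_sumr.
rewrite pair_bigA; apply: eq_bigr => -[om o] _ /=.
rewrite mulrA; congr (_ * _).
rewrite /prod_weight !(bigD1 i (P := xpredT)) //= ffunE eqxx.
rewrite mulrAC [RHS]mulrAC [P o * _]mulrC; congr (_ * _).
by apply: eq_bigr => j ne; rewrite ffunE (negbTE ne).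
Qed.

End Resampling.

(** * From sabotage cost to randomized query complexity of a composition *)

Section Composition.
Variable R : realType.

(* If finding a sabotaged position costs [tau] queries per success, every
   query of the simulated algorithm to the outer input is paid by [tau]
   queries of the composed algorithm. *)
Lemma rand_comp_sabotage (n N : nat) (f : pbfun n) (h : pbfun N)
    (Om : finType) (P : Om -> R) (X Y : Om -> N.-tuple bool) (tau : R) :
  (forall o, 0 <= P o) -> \sum_o P o = 1 ->
  (forall o, h (X o) = Some false) -> (forall o, h (Y o) = Some true) ->
  (forall t, tau * \sum_o P o * (sab_found t (X o) (Y o))%:R
      <= \sum_o P o * (sab_cost t (X o) (Y o))%:R) ->
  0 < tau ->
  (rand R f)%:R * tau <= 90 * (rand R (pbcomp f h))%:R.
Proof.
move=> P0 P1 hX hY hP tau0; have [A [Aok Aq]] := rand_alg R (pbcomp f h).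
set q := rand R (pbcomp f h) in Aq *.
pose inp (om : {ffun 'I_n -> Om}) (w : n.-tuple bool) :=
  sab_input (fun i => X (om i)) (fun i => Y (om i)) w.
have fh om w : pbcomp f h (inp om w) = f w.
  have hb i : h (block (inp om w) i) = Some (tnth w i).
    by rewrite block_sab_input; case: (tnth w i).
  rewrite /pbcomp; case: forallP => [_|[]]; last by move=> i; rewrite hb.
  by congr f; apply: eq_from_tnth => i; rewrite tnth_mktuple hb.
pose sim (j : 'I_(ra_size A)) (om : {ffun 'I_n -> Om}) :=
  simulate (fun i => X (om i)) (fun i => Y (om i)) (ra_tree A j) (fun=> None).
have kn (w : n.-tuple bool) : known (fun=> None) w by [].
have W0 om : 0 <= prod_weight P om by apply: prodr_ge0.
have cost j w : 0 < ra_prob A j -> isSome (f w) ->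
    tau * \sum_om prod_weight P om * (dt_queries (sim j om) w)%:R <= q%:R.
  move=> pj fw; set t := ra_tree A j.
  have cap om : (dt_queries t (inp om w) <= q)%N.
    rewrite -Aq /ra_cost.
    apply: leq_trans (leq_bigmax_cond _ pj).
    by apply: leq_trans (leq_bigmax_cond _ _) => //; rewrite fh.
  pose T i om := restrict_tree i t (inp om w).
  apply: (@le_trans _ _ (\sum_i tau * \sum_om prod_weight P om *
      (sab_found (T i om) (X (om i)) (Y (om i)))%:R)).
    rewrite -mulr_sumr ler_pM2l // exchange_big /=; apply: ler_sum => om _.
    rewrite -mulr_sumr ler_wpM2l // -natr_sum ler_nat.
    apply: leq_trans (simulate_queries _ _ _ (kn w)) _.
    by apply: leq_sum.
  apply: (@le_trans _ _ (\sum_i \sum_om prod_weight P om *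
      (sab_cost (T i om) (X (om i)) (Y (om i)))%:R)); last first.
    rewrite exchange_big /=.
    apply: (@le_trans _ _ (\sum_om prod_weight P om * q%:R)); last first.
      by rewrite -mulr_suml sum_prod_weight // mul1r.
    apply: ler_sum => om _; rewrite -mulr_sumr ler_wpM2l // -natr_sum ler_nat.
    by apply: leq_trans (cap om); apply: sab_cost_restrict.
  apply: ler_sum => i _.
  have := resample P1 i (fun om =>
    (sab_found (T i om) (X (om i)) (Y (om i)))%:R).
  have := resample P1 i (fun om =>
    (sab_cost (T i om) (X (om i)) (Y (om i)))%:R).
  move=> /= -> ->; rewrite mulr_sumr.
  apply: ler_sum => om _; rewrite mulrCA ler_wpM2l //.
  (* With the other coordinates fixed, the tree on block [i] is independent of the fresh pair, so
     [hP] applies to it. *)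
  have TE o : T i (ffun_update om i o) = T i om.
    apply: restrict_tree_ext => i' ne.
    by rewrite !block_sab_input ffunE (negbTE ne).
  under eq_bigr => o _ do rewrite TE ffunE eqxx.
  under [leRHS]eq_bigr => o _ do rewrite TE ffunE eqxx.
  exact: hP.
(* By Markov, more than [L] outer queries occur with probability at most 1/30; the error after
   truncation is 1/3 + 1/30 = 11/30. *)
pose L := Num.trunc (30 * q%:R / tau).
have Lq : 30 * q%:R / tau < L.+1%:R.
  by apply: Num.Theory.truncnS_gt.
have Lle : L%:R <= 30 * q%:R / tau.
  by rewrite Num.Theory.truncn_le // !mulr_ge0 // invr_ge0 ltW.
have sol : solves f L (11 / 30 : R).
  exists ('I_(ra_size A) * {ffun 'I_n -> Om})%type,
    (fun p => ra_prob A p.1 * prod_weight P p.2), (fun p => dt_trunc L (sim p.1 p.2)); split.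
  - by move=> p; rewrite mulr_ge0 // ra_prob_ge0.
  - rewrite -(pair_bigA _ (fun j om => ra_prob A j * prod_weight P om)) /=.
    rewrite -[RHS](ra_prob_sum1 A); apply: eq_bigr => j _.
    by rewrite -mulr_sumr sum_prod_weight // mulr1.
  - by move=> p; apply: depth_trunc.
  move=> w b fw; rewrite -(pair_bigA _ (fun j om => ra_prob A j * prod_weight P om *
    (dt_out (dt_trunc L (sim j om)) w == b)%:R)) /=.
  have fw' : isSome (f w) by rewrite fw.
  pose out om := \sum_j ra_prob A j * (dt_out (ra_tree A j) (inp om w) == b)%:R.
  have out_ge om : 2 / 3 <= out om.
    have := Aok (inp om w) b; rewrite fh fw -sum_indicator => /(_ erefl).
    by rewrite -/(out om); lra.
  pose late j om : R := (L < dt_queries (sim j om) w)%N%:R.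
  have late_le j : ra_prob A j * \sum_om prod_weight P om * late j om
      <= ra_prob A j * (1 / 30).
    have := ra_prob_ge0 j; rewrite le_eqVlt => /orP[/eqP<-|pj].
      by rewrite !mul0r.
    rewrite ler_pM2l //; have := cost j w pj fw'.
    set E := \sum_om _ => hE.
    have : L.+1%:R * \sum_om prod_weight P om * late j om <= E.
      rewrite mulr_sumr; apply: ler_sum => om _; rewrite mulrCA ler_wpM2l //.
      rewrite /late; by case: ltnP => hL; rewrite ?mulr1 ?mulr0 ?ler_nat.
    move: Lq; rewrite ltr_pdivrMr //.
    set Z := \sum_om _ => Lq hZ.
    have L0 : 0 < L.+1%:R :> R by rewrite ltr0n.
    rewrite -(ler_pM2l L0) -(ler_pM2r tau0).
    apply: le_trans (_ : tau * E <= _); first by rewrite mulrC ler_pM2l.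
    lra.
  apply: (@le_trans _ _ (\sum_om prod_weight P om * out om -
      \sum_j ra_prob A j * \sum_om prod_weight P om * late j om)).
    have : \sum_j ra_prob A j * \sum_om prod_weight P om * late j om <= 1 / 30.
      apply: le_trans (ler_sum _ (fun j _ => late_le j)) _.
      by rewrite -mulr_suml ra_prob_sum1 !mul1r.
    have : 2 / 3 <= \sum_om prod_weight P om * out om.
      apply: (@le_trans _ _ (\sum_(om : {ffun 'I_n -> Om}) prod_weight P om * (2 / 3))).
        by rewrite -mulr_suml sum_prod_weight // mul1r.
      by apply: ler_sum => om _; apply: ler_wpM2l.
    by lra.
  rewrite lerBlDr -[leRHS]big_split /=.
  under eq_bigr => om _ do rewrite mulr_sumr.
  rewrite exchange_big /=; apply: ler_sum => j _.
  rewrite mulr_sumr -big_split; apply: ler_sum => om _ /=.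
  rewrite [leRHS](_ : _ = prod_weight P om * (ra_prob A j *
    ((dt_out (dt_trunc L (sim j om)) w == b)%:R + late j om))); last by ring.
  rewrite ler_wpM2l // ler_wpM2l ?ra_prob_ge0 // /late.
  case: (ltnP L) => hL; first by case: (_ == _); case: (_ == _); rewrite /=; lra.
  by rewrite dt_out_trunc // simulate_out // addr0.
(* One vote suffices, as (11/30)^2 (3 - 22/30) < 1/3; it accounts for the constant 90 = 3 * 30. *)
have : (rand R f <= 3 * L)%N.
  apply: rand_le; apply: solves_le (solves_maj _ sol) => //; lra.
rewrite -(ler_nat R) natrM => hr.
move: Lle; rewrite ler_pdivlMr // => Lle.
have := ler_wpM2r (ltW tau0) hr.
by lra.
Qed.

End Composition.

(** * Potential of a single address block *)

Section Address.
Variables (R : realType) (k : nat) (S : finType) (inp : S -> k.-tuple bool)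
  (cls : S -> bool).
Implicit Types (nu : S -> R) (t : dtree k).

Definition tot_mass nu : R := \sum_x nu x.

(** Conditioning on an answer without renormalising, so masses of the two branches add up. *)
Definition cut nu (j : 'I_k) (v : bool) : S -> R :=
  fun x => nu x * (tnth (inp x) j == v)%:R.

Definition success nu t : R := \sum_x nu x * (dt_out t (inp x) == cls x)%:R.

(** Optimal mass guessed correctly with [r] queries, as a dynamic program over the first query
    rather than a maximum over the infinite type of trees. The default [best r' nu] makes it
    monotone in [r], even for [k = 0]. *)
Fixpoint best (r : nat) nu : R :=
  if r is r'.+1 then
    \big[Num.max/best r' nu]_(j < k)
      (best r' (cut nu j false) + best r' (cut nu j true))
  else Num.max (success nu (Leaf false)) (success nu (Leaf true)).

Lemma success_query nu j t0 t1 :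
  success nu (Query j t0 t1) =
  success (cut nu j false) t0 + success (cut nu j true) t1.
Proof.
rewrite /success -big_split /=; apply: eq_bigr => x _; rewrite /cut.
by case: (tnth (inp x) j); rewrite /= !mulr1 !mulr0 !mul0r ?addr0 ?add0r.
Qed.

Lemma best_attained r nu :
  exists2 t : dtree k, (depth t <= r)%N & best r nu = success nu t.
Proof.
elim: r nu => [|r IH] nu /=.
  case: (lerP (success nu (Leaf false)) (success nu (Leaf true))) => h.
    by exists (Leaf true).
  by exists (Leaf false).
apply: (big_ind (fun y => exists2 t : dtree k, (depth t <= r.+1)%N &
    y = success nu t)).
- by have [t tr ->] := IH nu; exists t => //; apply: leqW.
- by move=> x y [t tr ->] [t' tr' ->]; rewrite maxEle; case: ifP => _;
    [exists t' | exists t].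
move=> j _; have [t0 r0 ->] := IH (cut nu j false).
have [t1 r1 ->] := IH (cut nu j true).
by exists (Query j t0 t1); rewrite ?success_query //= ltnS geq_max r0.
Qed.

Lemma best_cut r nu j :
  best r (cut nu j false) + best r (cut nu j true) <= best r.+1 nu.
Proof.
exact: (le_bigmax _ (fun j => best r (cut nu j false) + best r (cut nu j true))).
Qed.

Lemma best0_le r nu : best 0 nu <= best r nu.
Proof.
elim: r => // r /le_trans; apply; exact: bigmax_ge_id.
Qed.

Lemma tot_mass_cut nu j : tot_mass nu = tot_mass (cut nu j false) + tot_mass (cut nu j true).
Proof.
rewrite /tot_mass -big_split /=; apply: eq_bigr => x _; rewrite /cut.
by case: (tnth (inp x) j); rewrite /= !mulr1 !mulr0 ?addr0 ?add0r.
Qed.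

Lemma cut_ge0 nu j v : (forall x, 0 <= nu x) -> forall x, 0 <= cut nu j v x.
Proof. by move=> nu0 x; rewrite mulr_ge0 // ler0n. Qed.

Lemma success_leaf_le nu b : success nu (Leaf b) <= best 0 nu.
Proof. by rewrite /best; case: b; rewrite le_max lexx ?orbT. Qed.

Lemma tot_mass_le_best0 nu : tot_mass nu <= 2 * best 0 nu.
Proof.
have -> : tot_mass nu = success nu (Leaf false) + success nu (Leaf true).
  rewrite /tot_mass /success -big_split /=; apply: eq_bigr => x _.
  by case: (cls x); rewrite /= mulr1 mulr0 ?addr0 ?add0r.
have := success_leaf_le nu false; have := success_leaf_le nu true.
by lra.
Qed.

Lemma success_le_tot_mass nu t : (forall x, 0 <= nu x) -> success nu t <= tot_mass nu.
Proof.
move=> nu0; apply: ler_sum => x _; rewrite ler_piMr //.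
by case: (_ == _).
Qed.

Lemma best0_le_tot_mass nu : (forall x, 0 <= nu x) -> best 0 nu <= tot_mass nu.
Proof. by move=> nu0; rewrite /best ge_max !success_le_tot_mass. Qed.

Lemma tot_mass_ge0 nu : (forall x, 0 <= nu x) -> 0 <= tot_mass nu.
Proof. by move=> nu0; apply: sumr_ge0. Qed.

Variables (Q M : nat).

(* Potential of one address block after [s] queries to it: the success bias
   still attainable with the remaining budget [Q - s], magnified by
   [2 ^ M.+1 - 1]; a block that exceeds its budget is given up. *)
Definition potential (s : nat) nu : R :=
  if (s <= Q)%N then tot_mass nu + (2 ^+ M.+1 - 1) * (2 * best (Q - s) nu - tot_mass nu)
  else tot_mass nu.

Let B0 : 0 <= 2 ^+ M.+1 - 1 :> R.
Proof. by rewrite subr_ge0 exprn_ege1 // ler1n. Qed.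

Lemma potential_ge_tot_mass s nu : tot_mass nu <= potential s nu.
Proof.
rewrite /potential; case: ifP => // _; rewrite lerDl mulr_ge0 // subr_ge0.
apply: le_trans (tot_mass_le_best0 nu) _; rewrite ler_pM2l //.
exact: best0_le.
Qed.

(** Supermartingale property. Total mass splits exactly, and a query followed by optimal play on
    both sides is one strategy for the larger budget. When the budget runs out the bias term, which
    is nonnegative, is dropped. *)
Lemma potential_cut s nu j : 
  potential s.+1 (cut nu j false) + potential s.+1 (cut nu j true)
    <= potential s nu.
Proof.
case: (ltnP s Q) => sQ; last first.
  apply: le_trans (potential_ge_tot_mass s nu).
  by rewrite /potential !ltnNge sQ /= -tot_mass_cut.
rewrite /potential sQ ltnW // (tot_mass_cut nu j).
have := ler_wpM2l B0 (best_cut (Q - s.+1) nu j).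
by rewrite -(subnSK sQ); lra.
Qed.

(** The convex function x^(l+1) lies below its chord on [1, 2], at [x = u / a]; cleared of
    denominators, this includes [a = 0]. *)
Lemma bias_power (a u : R) (l : nat) : 0 <= a -> a <= u -> u <= 2 * a ->
  u ^+ l.+1 <= (a + (2 ^+ l.+1 - 1) * (u - a)) * a ^+ l.
Proof.
move=> a0 au ua; elim: l => [|l IH]; first by rewrite !expr1 expr0; lra.
have u0 : 0 <= u by lra.
rewrite exprS; apply: le_trans (ler_wpM2l u0 IH) _.
rewrite mulrA [a ^+ l.+1]exprS mulrA ler_wpM2r ?exprn_ge0 //.
rewrite [2 ^+ l.+2]exprS.
have : 1 <= (2 : R) ^+ l.+1 by apply: exprn_ege1; rewrite ler1n.
set z := 2 ^+ l.+1 => z1.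
have : 0 <= (z - 1) * ((u - a) * (2 * a - u)) by rewrite !mulr_ge0 // subr_ge0.
by nra.
Qed.

(** Within budget this is the chord bound. Beyond it only the trivial [best 0 nu <= tot_mass nu]
    remains, at the price of a factor [2 ^+ M.+1]. *)
Lemma best0_power s nu : (forall x, 0 <= nu x) ->
  (2 * best 0 nu) ^+ M.+1 <=
  potential s nu * tot_mass nu ^+ M * (2 ^+ M.+1) ^+ (Q < s)%N.
Proof.
move=> nu0; have t0 := tot_mass_ge0 nu0.
have h1 := tot_mass_le_best0 nu; have h2 := best0_le_tot_mass nu0.
set b := best 0 nu in h1 h2 *.
rewrite /potential leqNgt; case: (Q < s)%N => /=.
  rewrite expr1 -exprS mulrC -exprMn ler_pXn2r ?nnegrE //; lra.
rewrite expr0 mulr1.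
have h3 : 2 * b <= 2 * tot_mass nu by lra.
apply: le_trans (bias_power M t0 h1 h3) _.
rewrite ler_wpM2r ?exprn_ge0 // lerD2l ler_wpM2l // lerD2r ler_pM2l //.
exact: best0_le.
Qed.

End Address.

(** * Cost of finding the addressed cell *)

Section Index.
Variables (R : realType) (k : nat) (S : finType) (inp : S -> k.-tuple bool)
  (cls : S -> bool) (c m : nat) (z0 z1 : k.-tuple bool).
(* [adr om] is the cell addressed by the classes of the [c] address blocks. *)
Variable adr : {ffun 'I_c -> S} -> nat.
Hypothesis adr_inj : forall p, exists b : 'I_c -> bool,
  forall om, adr om = p -> forall i, cls (om i) = b i.

Local Notation Om := {ffun 'I_c -> S}.
Implicit Types (om : Om) (nu : 'I_c -> S -> R) (t : dtree (m * k)).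

Definition ind_cell (v : bool) om (p : nat) : k.-tuple bool :=
  if insub p is Some i then inp (om i)
  else if v && (p == adr om) then z1 else z0.

Definition ind_input (v : bool) om : (m * k).-tuple bool :=
  [tuple let: (p, j) := block_pos e in tnth (ind_cell v om p) j | e < m * k].

Local Notation X := (ind_input false).
Local Notation Y := (ind_input true).

Definition weight nu om : R := \prod_i nu i (om i).

Definition mass nu (phi : Om -> R) : R := \sum_om weight nu om * phi om.

(* [A] lists the cells that were already queried without success. *)
Definition alive (A : seq nat) om : bool := adr om \notin A.

Definition mass_alive nu A : R := mass nu (fun om => (alive A om)%:R).
Definition mass_found nu A t : R :=
  mass nu (fun om => (alive A om && sab_found t (X om) (Y om))%:R).
Definition mass_cost nu A t : R :=
  mass nu (fun om => (alive A om * sab_cost t (X om) (Y om))%:R).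

Section Mass.
Variable nu : 'I_c -> S -> R.
Hypothesis nu0 : forall i x, 0 <= nu i x.

Lemma weight_ge0 om : 0 <= weight nu om.
Proof. by apply: prodr_ge0. Qed.

Lemma mass_le phi psi : (forall om, phi om <= psi om) -> mass nu phi <= mass nu psi.
Proof. by move=> h; apply: ler_sum => om _; rewrite ler_wpM2l ?weight_ge0. Qed.

Lemma mass_ge0 phi : (forall om, 0 <= phi om) -> 0 <= mass nu phi.
Proof. by move=> h; apply: sumr_ge0 => om _; rewrite mulr_ge0 ?weight_ge0. Qed.

Lemma massD phi psi :
  mass nu (fun om => phi om + psi om) = mass nu phi + mass nu psi.
Proof. by rewrite /mass -big_split; apply: eq_bigr => om _; rewrite mulrDr. Qed.

Lemma mass1 : mass nu (fun=> 1) = \prod_i tot_mass (nu i).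
Proof.
rewrite /mass /tot_mass bigA_distr_bigA /=.
by apply: eq_bigr => om _; rewrite mulr1.
Qed.

(** Being addressed by [p] forces the class of every block, and under a product measure the
    probabilities of these guesses multiply. *)
Lemma mass_adr p :
  mass nu (fun om => (adr om == p)%:R) <= \prod_i best inp cls 0 (nu i).
Proof.
have [b hb] := adr_inj p.
apply: (@le_trans _ _ (mass nu (fun om => \prod_i (cls (om i) == b i)%:R))).
  apply: mass_le => om; case: eqP => [/hb h|_]; last first.
    by apply: prodr_ge0 => i _; rewrite ler0n.
  by rewrite big1 // => i _; rewrite h eqxx.
have -> : mass nu (fun om => \prod_i (cls (om i) == b i)%:R) =
    \sum_(om : Om) \prod_i (nu i (om i) * (cls (om i) == b i)%:R).
  by apply: eq_bigr => om _; rewrite big_split.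
rewrite -(bigA_distr_bigA (fun i x => nu i x * (cls x == b i)%:R)) /=.
apply: ler_prod => i _; apply/andP; split.
  by apply: sumr_ge0 => x _; rewrite mulr_ge0 ?ler0n.
apply: le_trans (success_leaf_le inp cls (nu i) (b i)).
by apply: ler_sum => x _; rewrite eq_sym.
Qed.

(** Union bound over the excluded cells. *)
Lemma mass_alive_ge A : \prod_i tot_mass (nu i) <=
  mass_alive nu A + (size A)%:R * \prod_i best inp cls 0 (nu i).
Proof.
elim: A => [|p A IH]; first by rewrite -mass1 mul0r addr0.
apply: le_trans IH _; rewrite /= -[(size A).+1%:R]natr1 mulrDl mul1r addrA.
rewrite addrAC lerD2r.
apply: le_trans (_ : mass_alive nu (p :: A) + mass nu (fun om => (adr om == p)%:R) <= _).
  rewrite -massD; apply: mass_le => om; rewrite /alive inE.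
  by case: eqP; case: (_ \in A) => /= _ //; rewrite ?addr0 ?add0r ?lexx ?ler01.
by rewrite lerD2l mass_adr.
Qed.

End Mass.

(** A query to an address block conditions one factor, so the measure stays a product. Failed
    queries to data cells would break this; they are recorded in [A] instead. *)
Definition cut_at nu (i : 'I_c) j (v : bool) : 'I_c -> S -> R :=
  fun i' => if i' == i then cut inp (nu i') j v else nu i'.

Lemma cut_at_ge0 nu i j v :
  (forall i x, 0 <= nu i x) -> forall i' x, 0 <= cut_at nu i j v i' x.
Proof.
by move=> nu0 i' x; rewrite /cut_at; case: eqP => // _; apply: cut_ge0.
Qed.

Lemma weight_cut_at nu i j v om :
  weight (cut_at nu i j v) om = weight nu om * (tnth (inp (om i)) j == v)%:R.
Proof.
rewrite /weight !(bigD1 i (P := xpredT)) //= /cut_at eqxx /cut.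
rewrite mulrAC; congr (_ * _ * _); apply: eq_bigr => i' ne.
by rewrite (negbTE ne).
Qed.

Lemma mass_cut_at nu i j (phi psi0 psi1 : Om -> R) :
  (forall om, phi om = if tnth (inp (om i)) j then psi1 om else psi0 om) ->
  mass nu phi = mass (cut_at nu i j false) psi0 + mass (cut_at nu i j true) psi1.
Proof.
move=> h; rewrite /mass -big_split /=; apply: eq_bigr => om _.
rewrite h !weight_cut_at; case: (tnth _ _) => /=;
by rewrite !mulr1 !mulr0 !mul0r ?addr0 ?add0r.
Qed.

Variables (Q M d : nat).
Local Notation T := (Q.+1 * d)%N.
Local Notation pot s nu := (\prod_i potential inp cls Q M (s i) (nu i)).
Local Notation theta := (4 ^+ d / 2 ^+ c : R).
Local Notation kappa := (((2 ^+ M.+1) ^+ d)^-1 : R).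
Hypothesis theta_small : T%:R * theta <= 1 / 2.

Lemma pot_ge_tot_mass nu (s : 'I_c -> nat) : (forall i x, 0 <= nu i x) ->
  \prod_i tot_mass (nu i) <= pot s nu.
Proof.
move=> nu0; apply: ler_prod => i _.
by rewrite tot_mass_ge0 //= potential_ge_tot_mass.
Qed.

Lemma pot_ge0 nu (s : 'I_c -> nat) : (forall i x, 0 <= nu i x) -> 0 <= pot s nu.
Proof.
move=> nu0; apply: le_trans (pot_ge_tot_mass s nu0).
by apply: prodr_ge0 => i _; apply: tot_mass_ge0.
Qed.

Definition incr_at (s : 'I_c -> nat) (i : 'I_c) : 'I_c -> nat :=
  fun i' => if i' == i then (s i').+1 else s i'.

Lemma sum_incr_at s i : (\sum_i' incr_at s i i' = (\sum_i' s i').+1)%N.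
Proof.
rewrite (bigD1 i) //= [in RHS](bigD1 i) //= /incr_at eqxx addSn.
by congr (_ + _).+1; apply: eq_bigr => i' ne; rewrite (negbTE ne).
Qed.

Lemma pot_cut_at nu (s : 'I_c -> nat) i j : (forall i x, 0 <= nu i x) ->
  pot (incr_at s i) (cut_at nu i j false) + pot (incr_at s i) (cut_at nu i j true)
    <= pot s nu.
Proof.
move=> nu0; rewrite !(bigD1 i (P := xpredT)) //=.
rewrite /incr_at /cut_at !eqxx.
have E v : \prod_(i0 < c | i0 != i) potential inp cls Q M
    (if i0 == i then (s i0).+1 else s i0)
    (if i0 == i then cut inp (nu i0) j v else nu i0) =
    \prod_(i0 < c | i0 != i) potential inp cls Q M (s i0) (nu i0).
  by apply: eq_bigr => i0 ne; rewrite (negbTE ne).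
rewrite !E -mulrDl; apply: ler_wpM2r; last exact: potential_cut.
apply: prodr_ge0 => i0 _; apply: le_trans (potential_ge_tot_mass _ _ _ _ _ _).
exact: tot_mass_ge0.
Qed.

(* At most [d] blocks can exceed their budget within [T] queries. *)
Lemma best0_small nu (s : 'I_c -> nat) : (forall i x, 0 <= nu i x) ->
  (\sum_i s i <= T)%N ->
  kappa * pot s nu < \prod_i tot_mass (nu i) ->
  \prod_i best inp cls 0 (nu i) <= theta * \prod_i tot_mass (nu i).
Proof.
move=> nu0 sT good.
set V := \prod_i tot_mass (nu i) in good *; set b := \prod_i _.
have V0 : 0 < V.
  by apply: le_lt_trans good; rewrite mulr_ge0 ?pot_ge0 // invr_ge0 !exprn_ge0.
have b0 : 0 <= b.
  apply: prodr_ge0 => i _; have := tot_mass_le_best0 inp cls (nu i).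
  by have := tot_mass_ge0 (nu0 i); lra.
(* Each block beyond its budget has used up at least [Q.+1] of the [Q.+1 * d] queries. *)
have over : (\sum_i (Q < s i) <= d)%N.
  rewrite -(@leq_pmul2l Q.+1) // (leq_trans _ sT) // big_distrr /=.
  by apply: leq_sum => i _; case: ltnP; rewrite ?muln1 ?muln0.
have pow1 : 1 <= (2 : R) ^+ M.+1 by apply: exprn_ege1; rewrite ler1n.
have pow0 : 0 < (2 : R) ^+ M.+1 by apply: lt_le_trans pow1.
have step : (2 ^+ c * b) ^+ M.+1 <= pot s nu * V ^+ M * (2 ^+ M.+1) ^+ d.
  apply: (@le_trans _ _ (pot s nu * V ^+ M *
      (2 ^+ M.+1) ^+ (\sum_i (Q < s i))%N)); last first.
    apply: ler_wpM2l; last exact: ler_weXn2l.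
    by rewrite mulr_ge0 ?pot_ge0 // exprn_ge0 // ltW.
  have -> : 2 ^+ c * b = \prod_i (2 * best inp cls 0 (nu i)).
    by rewrite big_split prodr_const card_ord.
  rewrite -prodrXl -prodrXl (big_morph _ (exprD _) (expr0 _)) -!big_split /=.
  apply: ler_prod => i _; rewrite best0_power ?andbT //.
  rewrite exprn_ge0 //; have := tot_mass_le_best0 inp cls (nu i).
  by apply: le_trans; apply: tot_mass_ge0.
(* After the root, one factor [2 ^+ d] comes from [kappa] and the other from the blocks beyond their
   budget. *)
have lt : (2 ^+ c * b) ^+ M.+1 < (4 ^+ d * V) ^+ M.+1.
  apply: le_lt_trans step _.
  have -> : (4 ^+ d * V) ^+ M.+1 =
      ((2 ^+ M.+1) ^+ d * V) * V ^+ M * (2 ^+ M.+1) ^+ d.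
    rewrite exprMn (_ : 4 = 2 * 2 :> R); last by ring.
    rewrite !exprMn -!exprM [(M.+1 * d)%N]mulnC [V ^+ M.+1]exprS; ring.
  rewrite ltr_pM2r ?exprn_gt0 // ltr_pM2r ?exprn_gt0 //.
  by rewrite -ltr_pdivrMl // exprn_gt0.
have : 2 ^+ c * b < 4 ^+ d * V.
  rewrite -(ltr_pXn2r (ltn0Sn M)) ?nnegrE //.
    by rewrite mulr_ge0 ?exprn_ge0.
  by rewrite mulr_ge0 ?exprn_ge0 // ltW.
by move/ltW; rewrite mulrAC ler_pdivlMr ?exprn_gt0 // mulrC.
Qed.

Lemma tnth_ind_input v om (e : 'I_(m * k)) :
  tnth (ind_input v om) e =
  tnth (ind_cell v om (block_pos e).1) (block_pos e).2.
Proof. by rewrite tnth_mktuple; case: (block_pos e). Qed.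

Lemma ind_cell_addr v om (p : nat) (hp : (p < c)%N) :
  ind_cell v om p = inp (om (Ordinal hp)).
Proof. by rewrite /ind_cell insubT. Qed.

Lemma ind_cell_data v om (p : nat) : (c <= p)%N ->
  ind_cell v om p = if v && (p == adr om) then z1 else z0.
Proof. by move=> cp; rewrite /ind_cell insubF // ltnNge cp. Qed.

Lemma found_query_addr nu A (e : 'I_(m * k)) t0 t1 p j (hp : (p < c)%N) :
  (block_pos e).1 = p :> nat -> (block_pos e).2 = j ->
  let i := Ordinal hp in
  let nu' := cut_at nu i j in
  [/\ mass_found nu A (Query e t0 t1) =
        mass_found (nu' false) A t0 + mass_found (nu' true) A t1,
      mass_alive nu A = mass_alive (nu' false) A + mass_alive (nu' true) A &
      mass_cost nu A (Query e t0 t1) = mass_alive nu A +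
        (mass_cost (nu' false) A t0 + mass_cost (nu' true) A t1)].
Proof.
move=> ep ej i nu'.
have tE v om : tnth (ind_input v om) e = tnth (inp (om i)) j.
  by rewrite tnth_ind_input ep ej ind_cell_addr.
split.
- by apply: mass_cut_at => om; rewrite /= !tE eqxx /=; case: ifP.
- by apply: mass_cut_at => om; case: ifP.
rewrite -(@mass_cut_at nu i j (fun om => (alive A om * sab_cost
  (if tnth (inp (om i)) j then t1 else t0) (X om) (Y om))%:R)).
  rewrite -massD; apply: eq_bigr => om _; congr (_ * _).
  by rewrite /= !tE eqxx /= mulnS natrD.
by move=> om; case: ifP.
Qed.

(** Either [p] is the addressed cell and the run stops with success (mass [D]), or both inputs
    answer with the bit of [z0] and [p] joins the excluded cells. *)
Lemma found_query_data nu A (e : 'I_(m * k)) t0 t1 (p : nat) j :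
  (block_pos e).1 = p :> nat -> (block_pos e).2 = j -> (c <= p)%N ->
  tnth z0 j != tnth z1 j ->
  let t' := if tnth z0 j then t1 else t0 in
  let D := mass nu (fun om => (alive A om && (adr om == p))%:R) in
  [/\ mass_found nu A (Query e t0 t1) = D + mass_found nu (p :: A) t',
      mass_alive nu A = D + mass_alive nu (p :: A) &
      mass_cost nu A (Query e t0 t1) =
        mass_alive nu A + mass_cost nu (p :: A) t'].
Proof.
move=> ep ej cp z01 t' D.
have tX om : tnth (X om) e = tnth z0 j.
  by rewrite tnth_ind_input ep ej ind_cell_data.
have tY om : tnth (Y om) e = tnth (if adr om == p then z1 else z0) j.
  by rewrite tnth_ind_input ep ej ind_cell_data //= eq_sym.
rewrite /D -!massD; split; apply: eq_bigr => om _; congr (_ * _);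
  rewrite /alive inE /= ?tX ?tY; case: (adr om == p) => /=;
  rewrite ?z01 ?eqxx /= ?andbT ?andbF ?addr0 ?add0r ?mul0n ?addr0 ?muln1 //.
by rewrite mulnS natrD.
Qed.

Lemma found_query_idle nu A (e : 'I_(m * k)) t0 t1 (p : nat) j :
  (block_pos e).1 = p :> nat -> (block_pos e).2 = j -> (c <= p)%N ->
  tnth z0 j = tnth z1 j ->
  let t' := if tnth z0 j then t1 else t0 in
  mass_found nu A (Query e t0 t1) = mass_found nu A t' /\
  mass_cost nu A (Query e t0 t1) = mass_alive nu A + mass_cost nu A t'.
Proof.
move=> ep ej cp z01 t'.
have tE v om : tnth (ind_input v om) e = tnth z0 j.
  by rewrite tnth_ind_input ep ej ind_cell_data //; case: ifP.
split; last rewrite -massD; apply: eq_bigr => om _; congr (_ * _).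
  by rewrite /= !tE eqxx.
by rewrite /= !tE eqxx /= mulnS natrD.
Qed.

Hypothesis d0 : (0 < d)%N.

(** The terms pay for three ways to succeed: hitting the addressed cell while its posterior is
    small, at most [2 * theta] per query; reaching a branch where the potential is large; and
    exceeding [T] queries, which Markov bounds by the expected total number of queries over [T].
    Here [n0] bounds the relevant queries made so far. *)
Lemma found_bound t nu s A n0 :
  (forall i x, 0 <= nu i x) -> (\sum_i s i + size A <= n0)%N -> (n0 <= T)%N ->
  mass_found nu A t <=
    2 * theta * mass_cost nu A t + kappa * pot s nu
    + (n0%:R * mass_alive nu A + mass_cost nu A t) / T%:R.
Proof.
have T0 : 0 < T%:R :> R by rewrite ltr0n muln_gt0.
have th0 : 0 <= theta by rewrite divr_ge0 // exprn_ge0.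
have ka0 : 0 <= kappa by rewrite invr_ge0 !exprn_ge0.
have small := best0_small.
have tsm (V : R) : 0 <= V -> T%:R * (theta * V) <= 1 / 2 * V.
  by move=> V0; rewrite mulrA ler_wpM2r.
have leT n : (n <= T)%N -> n%:R <= T%:R :> R by rewrite ler_nat.
have eqT n : n = T -> n%:R = T%:R :> R by move=> ->.
move: T0 leT eqT tsm; set u : R := T%:R; move: u => u T0 leT eqT tsm.
move: tsm th0 ka0 small; generalize theta kappa => th ka tsm th0 ka0 small.
elim: t nu s A n0 => [b|e t0 IH0 t1 IH1] nu s A n0 nu0 sn nT.
all: have th2 : 0 <= 2 * th by apply: mulr_ge0.
all: have pot0 := pot_ge0 s nu0.
all: have al0 : 0 <= mass_alive nu A by apply: mass_ge0 => // om; rewrite ler0n.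
all: have co0 t : 0 <= mass_cost nu A t by apply: mass_ge0 => // om; rewrite ler0n.
  have -> : mass_found nu A (Leaf b) = 0.
    by rewrite /mass_found /mass big1 // => om _; rewrite andbF mulr0.
  apply: addr_ge0; last by rewrite mulr_ge0 ?invr_ge0 ?(ltW T0) ?addr_ge0 ?mulr_ge0.
  by apply: addr_ge0; apply: mulr_ge0.
have fa t : mass_found nu A t <= mass_alive nu A.
  by apply: mass_le => // om; rewrite ler_nat; case: (alive _ _) => //=; case: sab_found.
have aV : mass_alive nu A <= \prod_i tot_mass (nu i).
  by rewrite -mass1; apply: mass_le => // om; rewrite lern1; case: (alive _ _).
have c0 : 0 <= 2 * th * mass_cost nu A (Query e t0 t1) by apply: mulr_ge0.
(* At [n0 = T] the Markov term alone covers the whole alive mass. *)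
have [nT'|n0T] := leqP T n0.
  rewrite (eqT n0); last by apply/eqP; rewrite eqn_leq nT.
  rewrite [(_ + _) / _]mulrDl [u * _ / _]mulrAC divff ?gt_eqF // mul1r.
  have := fa (Query e t0 t1).
  have : 0 <= mass_cost nu A (Query e t0 t1) / u by rewrite divr_ge0 // ltW.
  have := mulr_ge0 ka0 pot0; lra.
have u0 : 0 <= u^-1 :> R by rewrite invr_ge0 ltW.
have nal0 : 0 <= n0%:R * mass_alive nu A by rewrite mulr_ge0.
(* On a branch of large potential the second term covers everything that can still be found. *)
have [bad|good] := lerP (\prod_i tot_mass (nu i)) (ka * pot s nu).
  have : 0 <= (n0%:R * mass_alive nu A + mass_cost nu A (Query e t0 t1)) / u.
    by rewrite mulr_ge0 // addr_ge0.
  by have := fa (Query e t0 t1); lra.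
(* For an address query the potential does not grow, and the alive mass added to the cost by this
   query pays for the step from [n0] to [n0.+1]. *)
have [hp|cp] := ltnP (block_pos e).1 c.
  have [-> hA ->] := @found_query_addr nu A e t0 t1 _ _ hp erefl erefl.
  set i := Ordinal hp in hA *; set j := (block_pos e).2 in hA *.
  have sn' : (\sum_i' incr_at s i i' + size A <= n0.+1)%N by rewrite sum_incr_at.
  have nu' v := @cut_at_ge0 nu i j v nu0.
  have := IH0 _ _ _ _ (nu' false) sn' n0T.
  have := IH1 _ _ _ _ (nu' true) sn' n0T.
  have := ler_wpM2l ka0 (pot_cut_at s i j nu0).
  have : 0 <= 2 * th * mass_alive nu A by apply: mulr_ge0.
  by rewrite hA -[n0.+1%:R]natr1; lra.
have z01 := eqVneq (tnth z0 (block_pos e).2) (tnth z1 (block_pos e).2).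
set t' := if tnth z0 (block_pos e).2 then t1 else t0.
have IH A' s' n' : (\sum_i s' i + size A' <= n')%N -> (n' <= T)%N ->
    mass_found nu A' t' <= 2 * th * mass_cost nu A' t' + ka * pot s' nu +
    (n'%:R * mass_alive nu A' + mass_cost nu A' t') / u.
  by rewrite /t'; case: ifP => _ *; [apply: IH1 | apply: IH0].
case: z01 => z01.
  have [-> ->] := @found_query_idle nu A e t0 t1 _ _ erefl erefl cp z01.
  have := IH A s n0.+1 (leq_trans sn (leqnSn _)) n0T.
  have : 0 <= 2 * th * mass_alive nu A by apply: mulr_ge0.
  by rewrite -/t' -[n0.+1%:R]natr1; lra.
have [-> hA ->] := @found_query_data nu A e t0 t1 _ _ erefl erefl cp z01.
rewrite -/t'; set p := nat_of_ord _ in hA *.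
set D := mass nu _ in hA *.
have sn' : (\sum_i s i + size (p :: A) <= n0.+1)%N by rewrite addnS ltnS.
have := IH (p :: A) s n0.+1 sn' n0T.
have D0 : 0 <= D by apply: mass_ge0 => // om; rewrite ler0n.
set b := \prod_i best inp cls 0 (nu i).
have Db : D <= b.
  apply: le_trans (mass_adr nu0 p); apply: mass_le => // om.
  by rewrite ler_nat; case: (alive _ _); case: (_ == _).
have bt : b <= th * \prod_i tot_mass (nu i).
  apply: small good => //; apply: leq_trans (leq_trans _ sn) nT.
  exact: leq_addr.
have hal := mass_alive_ge nu0 A; rewrite -/b in hal.
set V := \prod_i tot_mass (nu i) in aV good bt hal *.
have V0 : 0 <= V by apply: le_trans aV.
(* At most [T] cells are excluded, each of mass at most [th * V], and [T * th <= 1/2]: at least half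
   of the mass is alive. This is the factor 2 in [2 * th]. *)
have Val : V <= 2 * mass_alive nu A.
  have h1 : (size A)%:R * b <= u * (th * V).
    apply: ler_pM => //; first by apply: le_trans Db.
    apply: leT; apply: leq_trans nT; apply: leq_trans sn; exact: leq_addl.
  by have := tsm V V0; move: h1 hal; lra.
have DD : D <= 2 * th * mass_alive nu A.
  apply: le_trans Db (le_trans bt _).
  by rewrite -mulrA mulrCA ler_wpM2l.
have al' : mass_alive nu (p :: A) <= mass_alive nu A by rewrite hA; lra.
have n1 : 0 <= n0.+1%:R * u^-1 :> R by rewrite mulr_ge0.
have := ler_wpM2l n1 al'.
rewrite -[n0.+1%:R]natr1.
move: DD; set ma := mass_alive nu A; set ma' := mass_alive nu (p :: A).
set F := mass_found _ _ _; set C := mass_cost _ _ _.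
lra.
Qed.

End Index.

(** * Binary representation of addresses *)

Section BitsToNat.

Lemma foldl_bits v s :
  foldl (fun (v : nat) (b : bool) => (v.*2 + b)%N) v s =
  (v * 2 ^ size s + bits_to_nat s)%N.
Proof.
elim: s v => [|b s IH] v; first by rewrite /= muln1 addn0.
rewrite /bits_to_nat /= !IH expnS; case: b; lia.
Qed.

Lemma bits_to_nat_cons b s :
  bits_to_nat (b :: s) = (b * 2 ^ size s + bits_to_nat s)%N.
Proof. by rewrite {1}/bits_to_nat /= foldl_bits. Qed.

Lemma bits_to_nat_lt s : (bits_to_nat s < 2 ^ size s)%N.
Proof.
elim: s => // b s IH; rewrite bits_to_nat_cons /= expnS.
by case: b; lia.
Qed.

Lemma bits_to_nat_inj s s' :
  size s = size s' -> bits_to_nat s = bits_to_nat s' -> s = s'.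
Proof.
elim: s s' => [|b s IH] [|b' s'] //= [ss]; rewrite !bits_to_nat_cons ss => e.
have := bits_to_nat_lt s; have := bits_to_nat_lt s'; rewrite ss => l' l.
have bb : b = b' by move: e; case: b; case: b' => //=; lia.
by rewrite bb in e *; rewrite (IH s') //; lia.
Qed.

End BitsToNat.

(** * The address length against [m] *)

Section AddrSize.

Lemma addr_size_le m : (0 < m)%N -> (addr_size m + 2 ^ addr_size m <= m)%N.
Proof.
move=> m0; rewrite /addr_size.
have [|i hi ->] := @eq_bigmax_cond _ (fun c : 'I_m => (c + 2 ^ c <= m)%N) (fun c => c : nat).
  by apply/card_gt0P; exists (Ordinal m0).
exact: hi.
Qed.

(** By maximality of [c], [m < c.+1 + 2 ^ c.+1], and [c.+1] is below [2 ^ c.+1]. *)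
Lemma lt_addr_size m : (m < 2 ^ (addr_size m).+2)%N.
Proof.
set c := addr_size m; rewrite ltnNge; apply/negP => h.
have hc : (c.+1 + 2 ^ c.+1 <= m)%N.
  apply: leq_trans h; rewrite [(2 ^ c.+2)%N]expnS mul2n -addnn leq_add2r.
  exact: ltnW (ltn_expl _ _).
have cm : (c.+1 < m)%N.
  by apply: leq_trans hc; rewrite -addn1 leq_add2l expn_gt0.
suff : (c.+1 <= c)%N by rewrite ltnn.
exact: (@leq_bigmax_cond _ (fun c : 'I_m => (c + 2 ^ c <= m)%N)
  (fun c => c : nat) (Ordinal cm) hc).
Qed.

End AddrSize.

(** * The index function needs at most [c.+1] queries *)

Section IndexUpper.
Variables (R : realType) (m : nat).
Local Notation c := (addr_size m).

(** [l] address bits remain to be read and [v] is the value of those already read. A cell out of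
    range answers [false], like the default of [nth] in [Ind]. *)
Fixpoint ind_tree (l v : nat) : dtree m :=
  if l is l'.+1 then
    if insub (c - l)%N is Some i then
      Query i (ind_tree l' v.*2) (ind_tree l' (v.*2 + 1)%N)
    else Leaf false
  else if insub (c + v)%N is Some i then Query i (Leaf false) (Leaf true)
  else Leaf false.

Lemma depth_ind_tree l v : (depth (ind_tree l v) <= l.+1)%N.
Proof.
elim: l v => [|l IH] v; rewrite /=; case: insub => //= i.
by rewrite ltnS geq_max !IH.
Qed.

Lemma ind_tree_out l v (x : m.-tuple bool) : (0 < m)%N -> (l <= c)%N ->
  dt_out (ind_tree l v) x = nth false x
    (c + foldl (fun (v : nat) (b : bool) => (v.*2 + b)%N) v
           (drop (c - l) (take c x)))%N.
Proof.
move=> m0; have cm : (c < m)%N.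
  by apply: leq_trans (addr_size_le m0); rewrite -addn1 leq_add2l expn_gt0.
have sz : size (take c x) = c by rewrite size_takel // size_tuple ltnW.
elim: l v => [|l IH] v lc /=.
  rewrite subn0 drop_oversize ?sz //=.
  case: insubP => [i _ iE|]; last first.
    by rewrite -leqNgt => h; rewrite nth_default // size_tuple.
  by rewrite -iE /= (tnth_nth false); case: (nth _ _ _).
have lm : (c - l.+1 < m)%N by apply: leq_ltn_trans cm; apply: leq_subr.
rewrite insubT /= (drop_nth false); last by rewrite sz; lia.
rewrite nth_take; last lia.
rewrite (tnth_nth false) /= subnSK //.
case: (nth false x (c - l.+1)%N) => /=; rewrite IH ?addn0 //; exact: ltnW.
Qed.

Lemma rand_Ind_le : (0 < m)%N -> (rand R (Ind m) <= c.+1)%N.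
Proof.
move=> m0; apply: rand_le.
exists unit, (fun=> 1), (fun=> ind_tree c 0); split=> //.
- by rewrite big_const card_unit /= addr0.
- by move=> _; apply: depth_ind_tree.
move=> x b [<-]; rewrite big_const card_unit /= addr0 mul1r.
rewrite ind_tree_out // subnn drop0 -/(bits_to_nat _) nth_drop eqxx mulr1n.
by lra.
Qed.

End IndexUpper.

(** * The pairs of inputs have the values 0 and 1 *)

Section IndexPairs.
Variables (k m : nat) (g : pbfun k).
Local Notation c := (addr_size m).
Local Notation S := {x : k.-tuple bool | isSome (g x)}.
Variables (z0 z1 : k.-tuple bool).
Hypotheses (gz0 : g z0 = Some false) (gz1 : g z1 = Some true) (m0 : (0 < m)%N).

Definition addr_bits (om : {ffun 'I_c -> S}) : seq bool :=
  [seq dom_value (om i) | i <- enum 'I_c].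

Definition addr_cell (om : {ffun 'I_c -> S}) : nat :=
  (c + bits_to_nat (addr_bits om))%N.

Lemma size_addr_bits om : size (addr_bits om) = c.
Proof. by rewrite size_map -cardE card_ord. Qed.

Lemma addr_cell_lt om : (addr_cell om < m)%N.
Proof.
apply: leq_trans (addr_size_le m0); rewrite ltn_add2l.
by have := bits_to_nat_lt (addr_bits om); rewrite size_addr_bits.
Qed.

Lemma addr_cell_inj p : exists b : 'I_c -> bool,
  forall om, addr_cell om = p -> forall i, dom_value (om i) = b i.
Proof.
have [[om0 p0]|nex] := pselect (exists om, addr_cell om = p); last first.
  by exists (fun=> false) => om omp; case: nex; exists om.
exists (fun i => dom_value (om0 i)) => om omp i.
have : addr_bits om = addr_bits om0.
  apply: bits_to_nat_inj; first by rewrite !size_addr_bits.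
  by apply: (@addnI c); rewrite -[LHS]/(addr_cell om) omp -p0.
by move/eq_in_map; apply; rewrite mem_enum.
Qed.

Lemma pbcomp_ind_input v om :
  pbcomp (Ind m) g (ind_input val m z0 z1 addr_cell v om) = Some v.
Proof.
set x := ind_input _ _ _ _ _ _ _.
pose bit (p : nat) := if insub p is Some i then dom_value (om i)
  else v && (p == addr_cell om).
have gb (p : 'I_m) : g (block x p) = Some (bit p).
  have -> : block x p = ind_cell val z0 z1 addr_cell v om p.
    by apply: eq_from_tnth => j; rewrite tnth_mktuple tnth_ind_input mxvec_indexK.
  rewrite /ind_cell /bit; case: insub => [i|]; first exact: dom_valueE.
  by case: (_ && _).
rewrite /pbcomp; case: forallP => [_|[]]; last by move=> p; rewrite gb.
set y := [tuple _ | _ < _]; rewrite /Ind; congr Some.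
have yE q : (q < m)%N -> nth false y q = bit q.
  move=> qm; rewrite -[q]/(nat_of_ord (Ordinal qm)) -(tnth_nth false).
  by rewrite tnth_mktuple gb.
have cm : (c < m)%N.
  by apply: leq_trans (addr_size_le m0); rewrite -addn1 leq_add2l expn_gt0.
have -> : take c y = addr_bits om.
  have sz : size (take c y) = c by rewrite size_takel // size_tuple ltnW.
  apply: (@eq_from_nth _ false); first by rewrite sz size_addr_bits.
  rewrite sz => q qc; rewrite nth_take // yE ?(ltn_trans qc) // /bit insubT.
  rewrite (nth_map (Ordinal qc)) -?cardE ?card_ord //.
  congr (dom_value (om _)); apply: val_inj.
  by rewrite /= nth_enum_ord.
rewrite nth_drop yE ?addr_cell_lt // /bit insubF ?eqxx ?andbT //.
by rewrite ltnNge leq_addr.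
Qed.

End IndexPairs.

(** * Lower bounds for the triple composition *)

Section Lower.
Variable R : realType.

(** A single fixed pair with [tau = 1]: finding a difference takes at least one query. This serves
    when the address is short. *)
Lemma rand_outer_le n N (f : pbfun n) (h : pbfun N) x0 x1 :
  h x0 = Some false -> h x1 = Some true ->
  (rand R f)%:R <= 90 * (rand R (pbcomp f h))%:R :> R.
Proof.
move=> h0 h1; rewrite -[leLHS]mulr1.
apply: (@rand_comp_sabotage R n N f h unit (fun=> 1) (fun=> x0) (fun=> x1)) => //.
- by rewrite big_const card_unit /= addr0.
- by move=> t; rewrite !big_const card_unit /= !addr0 !mul1r ler_nat
    sab_found_le_cost.
Qed.

Lemma rand_gt0_values k (g : pbfun k) : (0 < rand R g)%N ->
  exists z0 z1, g z0 = Some false /\ g z1 = Some true.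
Proof.
move=> r0.
have val b : exists z, g z = Some b.
  apply: contrapT => nz; move: r0.
  rewrite (@rand_constant R k g (~~ b)) // => x; rewrite negbK => gx.
  by apply: nz; exists x.
by have [z0 g0] := val false; have [z1 g1] := val true; exists z0, z1.
Qed.

(* The hard address blocks force [Q.+1 * (c %/ 40)] queries per found
   sabotaged cell. *)
Lemma index_sabotage_bound n k m (f : pbfun n) (g : pbfun k) (Q : nat) :
  let d := (addr_size m %/ 40)%N in
  (0 < m)%N -> (0 < d)%N ->
  (2 * (Q.+1 * d) * 4 ^ d <= 2 ^ addr_size m)%N ->
  ~ solves g Q (1 / 2 - (4 * 2 ^+ 160)^-1 : R) ->
  (rand R f)%:R * (Q.+1 * d)%:R
    <= 270 * (rand R (pbcomp f (pbcomp (Ind m) g)))%:R :> R.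
Proof.
move=> d m0 d0 Tsmall nsol; set c := addr_size m in Tsmall *.
set T := (Q.+1 * d)%N in Tsmall *.
have [z0 [z1 [gz0 gz1]]] : exists z0 z1, g z0 = Some false /\ g z1 = Some true.
  have val b : exists z, g z = Some b.
    apply: contrapT => nz; apply: nsol; exists unit, (fun=> 1), (fun=> Leaf (~~ b)).
    split=> //; first by rewrite big_const card_unit /= addr0.
    move=> x b' gx; rewrite big_const card_unit /= addr0 mul1r.
    have -> : ~~ b == b'.
      by case: b b' gx nz => [] [] // gx nz; case: nz; exists x.
    have : 0 <= (4 * 2 ^+ 160)^-1 :> R by rewrite invr_ge0 mulr_ge0 ?exprn_ge0.
    by rewrite mulr1n; lra.
  by have [w0 g0] := val false; have [w1 g1] := val true; exists w0, w1.
have p160 : 1 <= (2 : R) ^+ 160 by apply: exprn_ege1; rewrite ler1n.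
have p2 : 2 <= (2 : R) ^+ 160.
  by rewrite exprS; have : 1 <= (2 : R) ^+ 159; [apply: exprn_ege1; rewrite ler1n | lra].
set z := 2 ^+ 160 in nsol p160 p2.
have zN0 : z != 0 by rewrite gt_eqF //; lra.
have dl0 : 0 < (4 * z)^-1 <= 1 / 8.
  have z4 : 0 < 4 * z by lra.
  by rewrite invr_gt0 z4 div1r lef_pV2 ?posrE //=; lra.
have [mu [mu0 mu1 muQ]] := @hard_distribution R k g Q _ dl0 nsol.
pose S : finType := {x : k.-tuple bool | isSome (g x)}.
pose inp : S -> k.-tuple bool := val.
pose cls : S -> bool := @dom_value k g.
pose nu : 'I_c -> S -> R := fun=> mu.
pose adr := @addr_cell k m g.
have nu0 i x : 0 <= nu i x by exact: mu0.
have nu1 : \sum_om weight nu om = 1.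
  transitivity (mass nu (fun=> 1)); first by apply: eq_bigr => om _; rewrite mulr1.
  by rewrite mass1 big1.
have T0 : 0 < T%:R :> R by rewrite ltr0n muln_gt0.
(* The advantage [2 * best - 1] is at most [4 * (4 * z)^-1 = z^-1], so magnified by [z - 1] it stays
   below 1 and each factor is at most 2. *)
have root : \prod_(i < c) potential inp cls Q 159 0 (nu i) <= 2 ^+ c.
  rewrite -[c in leRHS]card_ord -prodr_const; apply: ler_prod => i _.
  apply/andP; split.
    by apply: le_trans (potential_ge_tot_mass _ _ _ _ _ _); apply: tot_mass_ge0.
  rewrite /potential leq0n subn0 -/z /tot_mass mu1.
  have [t tQ ->] := best_attained inp cls Q mu.
  have bt : success inp cls mu t <= 1 / 2 + 2 * (4 * z)^-1 by exact: muQ.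
  have z0' : 0 <= z - 1 by lra.
  apply: le_trans (_ : 1 + (z - 1) * (4 * (4 * z)^-1) <= _).
    by rewrite lerD2l ler_wpM2l //; lra.
  have -> : (z - 1) * (4 * (4 * z)^-1) = 1 - z^-1 by field.
  have : 0 <= z^-1 by rewrite invr_ge0; lra.
  by lra.
have theta_small : T%:R * (4 ^+ d / 2 ^+ c) <= 1 / 2 :> R.
  move: Tsmall; rewrite -(ler_nat R) !natrM !natrX => h.
  by rewrite mulrA ler_pdivrMr ?exprn_gt0 //; lra.
(* Origin of 160: [T <= 2 ^ c], so [2 c <= 160 d] is enough, and [c < 40 (d + 1) <= 80 d]. *)
have kappa_small : ((2 ^+ 160) ^+ d)^-1 * 2 ^+ c <= T%:R^-1 :> R.
  rewrite ler_pdivrMl ?exprn_gt0 // ler_pdivlMr //.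
  rewrite -exprM -!natrX -natrM ler_nat.
  have Tc : (T <= 2 ^ c)%N.
    apply: leq_trans Tsmall; rewrite -[leqLHS]muln1 leq_mul ?expn_gt0 //.
    by rewrite leq_pmull.
  apply: leq_trans (leq_mul (leqnn _) Tc) _.
  rewrite -expnD leq_pexp2l // addnn.
  have := ltn_ceil c (isT : 0 < 40)%N; rewrite -/d.
  by move: d0; lia.
(* Each of the three terms of [found_bound] will be at most the expected cost over [T], whence
   [T / 3] and 270 = 3 * 90. *)
have := @rand_comp_sabotage R n _ f (pbcomp (Ind m) g) {ffun 'I_c -> S}
  (weight nu) (ind_input inp m z0 z1 adr false)
  (ind_input inp m z0 z1 adr true) (T%:R / 3).
suff hT : forall t : dtree (m * k), T%:R / 3 * (\sum_om weight nu om *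
     (sab_found t (ind_input inp m z0 z1 adr false om)
       (ind_input inp m z0 z1 adr true om))%:R) <=
    \sum_om weight nu om *
     (sab_cost t (ind_input inp m z0 z1 adr false om)
       (ind_input inp m z0 z1 adr true om))%:R.
  move=> /(_ (weight_ge0 nu0) nu1 _ _ hT) => h.
  have : (rand R f)%:R * (T%:R / 3)
      <= 90 * (rand R (pbcomp f (pbcomp (Ind m) g)))%:R :> R.
    by apply: h; [move=> om; apply: pbcomp_ind_input |
       move=> om; apply: pbcomp_ind_input | lra].
  by lra.
move=> t.
have [[b ->]|[e [t0 [t1 tE]]]] : (exists b, t = Leaf b) \/
    exists e t0 t1, t = Query e t0 t1.
    by case: t => [b|e t0 t1]; [left; exists b | right; exists e, t0, t1].
  by rewrite !big1 ?mulr0 // => om _; rewrite mulr0.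
have adr_inj p : exists b : 'I_c -> bool,
    forall om, adr om = p -> forall i, cls (om i) = b i.
  exact: (@addr_cell_inj k m g p).
have := @found_bound R k S inp cls c m z0 z1 adr adr_inj Q 159 d
  theta_small d0 t nu (fun=> 0%N) [::] 0%N nu0.
rewrite big1 // => /(_ isT isT).
rewrite mul0r add0r.
have -> : mass_found inp z0 z1 adr nu [::] t = \sum_om weight nu om *
     (sab_found t (ind_input inp m z0 z1 adr false om)
       (ind_input inp m z0 z1 adr true om))%:R by [].
have -> : mass_cost inp z0 z1 adr nu [::] t = \sum_om weight nu om *
     (sab_cost t (ind_input inp m z0 z1 adr false om)
       (ind_input inp m z0 z1 adr true om))%:R.
  by apply: eq_bigr => om _; rewrite mul1n.
set F := \sum_om _; set E := \sum_om _ => hF.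
(* A tree that is not a leaf costs at least 1, so the additive [1 / T] is at most [E / T]. *)
have E1 : 1 <= E.
  rewrite -nu1; apply: ler_sum => om _; rewrite ler_peMr ?weight_ge0 //.
  by rewrite tE ler1n.
have hk : ((2 ^+ 160) ^+ d)^-1 * \prod_(i < c) potential inp cls Q 159 0 (nu i)
    <= T%:R^-1 :> R.
  apply: le_trans kappa_small; apply: ler_wpM2l root.
  by rewrite invr_ge0 !exprn_ge0.
move: theta_small hF hk E1; set th := 4 ^+ d / 2 ^+ c; set P := _ * \prod_(_ < _) _.
move: th P F E => th P F E; rewrite -ler_pdivlMl // => hth hF hP E1.
rewrite mulrAC ler_pdivrMr // -ler_pdivlMl //.
have iT0 : 0 <= T%:R^-1 :> R by rewrite invr_ge0 ltW.
apply: le_trans hF _.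
clear T0 kappa_small.
move: T%:R^-1 hth hP iT0 => u hth hP u0.
have := ler_wpM2r (le_trans ler01 E1) hth.
have := ler_wpM2l u0 E1.
by lra.
Qed.

End Lower.

(** * Choice of the constants *)

Section Constants.
Variable R : realType.

Lemma powR_exp11 (x : R) : 0 <= x -> (x `^ (11 / 10)) ^+ 10 = x ^+ 11.
Proof.
move=> x0; rewrite -powR_mulrn ?powR_ge0 // -powRrM.
by rewrite (_ : 11 / 10 * 10%:R = 11%:R) ?powR_mulrn //; field.
Qed.

Lemma nat_le_powR (r : nat) : r%:R <= r%:R `^ (11 / 10) :> R.
Proof.
case: r => [|r]; first by rewrite powR_ge0.
rewrite -[leLHS]powRr1 //; apply: ler_powR; first by rewrite ler1n.
by lra.
Qed.

(* The exponent 11/10 leaves a factor [2 ^ (c - c / 1.1)] of slack, which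
   absorbs the polynomial and constant factors once [d = c / 40] is large. *)
Lemma index_size_slack (C : R) (r m d0 : nat) :
  let c := addr_size m in let d := (c %/ 40)%N in
  0 < C -> C * r%:R `^ (11 / 10) <= m%:R ->
  2 ^+ 31 <= C ^+ 10 * 2 ^+ d0 -> (d0 <= d)%N ->
  (2 * (r * d) * 4 ^ d <= 2 ^ c)%N.
Proof.
move=> c d C0 hm hd0 dd.
have mc : m%:R <= 2 ^+ c.+2 :> R.
  by rewrite -natrX ler_nat ltnW // lt_addr_size.
have hr : C ^+ 10 * r%:R ^+ 11 <= 2 ^+ (c.+2 * 10).
  rewrite -powR_exp11 // -exprMn exprM.
  apply: lerXn2r; rewrite ?nnegrE ?exprn_ge0 ?mulr_ge0 ?powR_ge0 ?(ltW C0) //.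
  exact: le_trans hm mc.
have h40 : (40 * d <= c)%N by rewrite mulnC leq_trunc_div.
(* The 11th power produces [r ^ 11], the 10th power of [r] to the 11/10, which [hr] bounds. *)
rewrite -(ler_nat R) natrX -(@ler_pXn2r _ 11) ?nnegrE ?exprn_ge0 //.
have C10 : 0 < C ^+ 10 by rewrite exprn_gt0.
rewrite -(ler_pM2l C10) -exprM.
apply: (@le_trans _ _ (2 ^+ (11 + 33 * d) * (C ^+ 10 * r%:R ^+ 11))).
  rewrite [leRHS]mulrCA ler_wpM2l ?(ltW C10) // -!natrX -natrM ler_nat.
  have -> : (2 ^ (11 + 33 * d) * r ^ 11 = (2 ^ (1 + 3 * d) * r) ^ 11)%N.
    by rewrite expnMn -expnM; congr (2 ^ _ * _)%N; lia.
  rewrite leq_exp2r // (_ : (4 = 2 ^ 2)%N) // -expnM.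
  rewrite (_ : (1 + 3 * d = 1 + d + 2 * d)%N); last lia.
  rewrite (expnD 2 (1 + d)) (expnD 2 1 d) expn1; have := ltnW (ltn_expl d (isT : 1 < 2)%N).
  move: (2 ^ d)%N (2 ^ (2 * d))%N => q p dq.
  have -> : (2 * (r * d) * p = 2 * r * p * d)%N by lia.
  have -> : (2 * q * p * r = 2 * r * p * q)%N by lia.
  by rewrite leq_mul2l dq orbT.
apply: le_trans (ler_wpM2l _ hr) _; first by rewrite exprn_ge0.
rewrite -exprD.
have -> : (11 + 33 * d + c.+2 * 10 = 31 + (33 * d + 10 * c))%N by lia.
rewrite exprD.
apply: le_trans (ler_wpM2r _ hd0) _; first by rewrite exprn_ge0.
(* What remains is [d0 + 33 d + 10 c <= 11 c], from [d0 <= d] and [40 d <= c]. *)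
rewrite -mulrA ler_wpM2l ?(ltW C10) // -exprD ler_weXn2l ?ler1n //.
by move: h40 dd; lia.
Qed.

(** A long address is the case of [index_sabotage_bound]. If [c] is bounded, so are [m] and hence
    [rand R g], and the bound by [rand R f] alone is enough. *)
Lemma index_comp_bound (C : R) : 0 < C ->
  exists2 c0 : R, 0 < c0 & forall (n k m : nat) (f : pbfun n) (g : pbfun k),
    (0 < m)%N -> C * (rand R g)%:R `^ (11 / 10) <= m%:R ->
    c0 * ((rand R f)%:R * (rand R g)%:R * (addr_size m).+1%:R)
      <= (rand R (pbcomp f (pbcomp (Ind m) g)))%:R.
Proof.
move=> C0.
have dl0 : 0 < (4 * 2 ^+ 160)^-1 :> R by rewrite invr_gt0 mulr_gt0 ?exprn_gt0.
have [K hK] := solves_majK dl0.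
have [d0 d00 hd0] : exists2 d0 : nat, (0 < d0)%N & 2 ^+ 31 <= C ^+ 10 * 2 ^+ d0.
  have C10 : 0 < C ^+ 10 by rewrite exprn_gt0.
  exists (Num.bound (2 ^+ 31 / C ^+ 10)).+1 => //.
  rewrite -ler_pdivrMl // mulrC.
  apply: le_trans (_ : (Num.bound (2 ^+ 31 / C ^+ 10))%:R <= _).
    by rewrite ltW // archi_boundP // divr_ge0 ?exprn_ge0 // ltW.
  by rewrite -[leRHS]natrX ler_nat; apply: ltnW (ltnW (ltn_expl _ _)).
(* 21600 = 270 * 80, where 80 comes from [c.+1 <= 80 * (c %/ 40)]. *)
pose e1 : R := 21600 * (3 ^ K)%:R.
pose e2 : R := 90 * (2 ^+ (40 * d0).+1 / C) * (40 * d0)%:R.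
have e10 : 0 < e1 by rewrite mulr_gt0 // ltr0n expn_gt0.
have e20 : 0 < e2 by rewrite !mulr_gt0 ?invr_gt0 ?exprn_gt0 // ltr0n muln_gt0.
exists (e1 + e2)^-1; first by rewrite invr_gt0 addr_gt0.
move=> n k m f g m0 hm; rewrite ler_pdivrMl ?addr_gt0 //.
set X := (rand R (pbcomp _ _))%:R; have X0 : 0 <= X by rewrite ler0n.
set c := addr_size m; set rf := rand R f; set r := rand R g in hm *.
have e0 : 0 <= e1 + e2 by apply: addr_ge0; apply: ltW.
have [r0|rpos] := posnP r; first by rewrite r0 mulr0 mul0r mulr_ge0.
have [z0 [z1 [gz0 gz1]]] := rand_gt0_values rpos.
have [dd|dd] := leqP d0 (c %/ 40).
  have dpos : (0 < c %/ 40)%N by apply: leq_trans dd.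
  have K0 : (0 < 3 ^ K)%N by rewrite expn_gt0.
  (* The largest [Q] with [3 ^ K * Q < r]: an algorithm with the tiny advantage and [Q] queries
     would be amplified to fewer than [r] queries. *)
  set Q := ((r.-1) %/ 3 ^ K)%N.
  have Qr : (Q < r)%N by apply: leq_ltn_trans (leq_div _ _) _; rewrite prednK.
  have rQ : (r <= 3 ^ K * Q.+1)%N.
    by rewrite mulnC -(prednK rpos); apply: ltn_ceil.
  have nsol : ~ solves g Q (1 / 2 - (4 * 2 ^+ 160)^-1 : R).
    move=> /hK; rewrite -/r leqNgt => /negP; apply.
    by rewrite mulnC (leq_ltn_trans (leq_trunc_div _ _)) // prednK.
  have slack := index_size_slack C0 hm hd0 dd.
  have Tsmall : (2 * (Q.+1 * (c %/ 40)) * 4 ^ (c %/ 40) <= 2 ^ c)%N.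
    by apply: leq_trans slack; rewrite leq_mul2r leq_mul2l leq_mul2r Qr !orbT.
  have := index_sabotage_bound f m0 dpos Tsmall nsol; rewrite -/X -/rf => hX.
  have hc : (r * c.+1 <= 3 ^ K * (80 * (Q.+1 * (c %/ 40))))%N.
    rewrite [(80 * _)%N]mulnCA mulnA leq_mul //.
    by have := ltn_ceil c (isT : 0 < 40)%N; lia.
  apply: (@le_trans _ _ (e1 * X)); last by rewrite ler_wpM2r // lerDl ltW.
  rewrite -mulrA -natrM.
  apply: le_trans (ler_wpM2l (ler0n _ rf) (_ : _ <= (3 ^ K * (80 * (Q.+1 * (c %/ 40))))%:R)) _.
    by rewrite ler_nat.
  have := ler_wpM2l (ler0n R (3 ^ K * 80)) hX.
  rewrite /e1 !natrM; set t := (c %/ 40)%:R; set q := Q.+1%:R; set w := (3 ^ K)%:R.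
  move: t q w => t q w; lra.
have cd : (c < 40 * d0)%N.
  by have := ltn_ceil c (isT : 0 < 40)%N; move: dd; lia.
have hX : rf%:R <= 90 * X.
  have dz0 : isSome (g z0) by rewrite gz0.
  pose om : {ffun 'I_c -> {x : k.-tuple bool | isSome (g x)}} :=
    [ffun=> exist _ z0 dz0].
  exact: (@rand_outer_le R n _ f (pbcomp (Ind m) g) _ _
    (pbcomp_ind_input gz0 gz1 m0 false om)
    (pbcomp_ind_input gz0 gz1 m0 true om)).
have hr : r%:R <= 2 ^+ (40 * d0).+1 / C.
  rewrite ler_pdivlMr // mulrC.
  apply: le_trans (ler_wpM2l (ltW C0) (nat_le_powR r)) (le_trans hm _).
  rewrite -natrX ler_nat; apply: leq_trans (ltnW (lt_addr_size m)) _.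
  by rewrite leq_pexp2l // ltnS.
apply: (@le_trans _ _ (e2 * X)); last by rewrite ler_wpM2r // lerDr ltW.
have -> : e2 * X = 90 * X * (2 ^+ (40 * d0).+1 / C * (40 * d0)%:R).
  by rewrite /e2 -[90 * _ * _]mulrA mulrAC.
by rewrite -mulrA ler_pM ?mulr_ge0 ?ler0n ?ler_pM ?ler_nat ?ler0n.
Qed.

End Constants.

(** * The address length is of the order of the logarithm of [m] *)

Section Log.
Variable R : realType.

Lemma ln2_gt0 : 0 < ln 2 :> R.
Proof. by rewrite ln_gt0 // ltr1n. Qed.

Lemma log2_pow2 (l : nat) : log2 (2 ^+ l) = l%:R :> R.
Proof.
rewrite /log2 lnXn // -[_ *+ l]mulr_natl mulfK ?gt_eqF //; exact: ln2_gt0.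
Qed.

Lemma le_log2 (x y : R) : 0 < x -> x <= y -> log2 x <= log2 y.
Proof.
move=> x0 xy; rewrite /log2 ler_pM2r ?invr_gt0 ?ln2_gt0 //.
by rewrite ler_ln ?posrE // (lt_le_trans x0).
Qed.

Lemma log2_le_addr m : (0 < m)%N -> log2 m%:R <= 2 * (addr_size m).+1%:R :> R.
Proof.
move=> m0; apply: le_trans (_ : (addr_size m).+2%:R <= _); last first.
  by rewrite -natrM ler_nat; lia.
rewrite -[leRHS]log2_pow2; apply: le_log2; first by rewrite ltr0n.
by rewrite -natrX ler_nat ltnW // lt_addr_size.
Qed.

Lemma addr_le_log2 m : (1 < m)%N -> (addr_size m).+1%:R <= 2 * log2 m%:R :> R.
Proof.
move=> m1; have h1 : 1 <= log2 m%:R :> R.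
  by rewrite -[leLHS](log2_pow2 1) le_log2 // expr1 ler_nat.
have h2 : (addr_size m)%:R <= log2 m%:R :> R.
  rewrite -[leLHS]log2_pow2 le_log2 ?exprn_gt0 // -natrX ler_nat.
  by apply: leq_trans (addr_size_le (ltnW m1)); apply: leq_addl.
by rewrite -natr1; lra.
Qed.

End Log.

Theorem theorem1 (R : realType) (C : R) (hC : 0 < C) :
  exists c1 c2 c3 : R,
    [/\ 0 < c1, 0 < c2, 0 < c3 &
      forall (n k m : nat) (f : pbfun n) (g : pbfun k),
        (0 < m)%N ->
        C * (rand R g)%:R `^ (11 / 10) <= m%:R ->
        [/\ c1 * ((rand R f)%:R * (rand R g)%:R * log2 m%:R)
              <= (rand R (pbcomp f (pbcomp (Ind m) g)))%:R,
            c2 * ((rand R f)%:R * (rand R (Ind m))%:R * (rand R g)%:R)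
              <= (rand R (pbcomp f (pbcomp (Ind m) g)))%:R &
            (1 < m)%N ->
            c3 * ((rand R f)%:R * (rand R (Ind m))%:R * (rand R g)%:R)
              <= (rand R f)%:R * (rand R g)%:R * log2 m%:R]].
Proof.
have [c0 c00 bound] := index_comp_bound hC.
(* Both factors 1/2 come from comparing [log2 m] with [c.+1]. For the index function only the upper
   bound [c.+1] is needed, since it occurs on the smaller sides. *)
exists (c0 / 2), c0, (1 / 2); split; [lra | lra | lra |].
move=> n k m f g m0 hm; have {bound} := bound n k m f g m0 hm.
set X := (rand R (pbcomp _ _))%:R; set a := (rand R f)%:R; set b := (rand R g)%:R.
have ab0 : 0 <= a * b by rewrite mulr_ge0 ?ler0n.
have hI : (rand R (Ind m))%:R <= (addr_size m).+1%:R :> R.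
  by rewrite ler_nat rand_Ind_le.
move=> main; split.
- apply: le_trans main; rewrite -mulrA ler_pM2l // mulrCA ler_wpM2l //.
  by have := log2_le_addr R m0; lra.
- by apply: le_trans main; rewrite ler_pM2l // mulrAC ler_wpM2l.
move=> m1; rewrite [a * _ * b]mulrAC mulrCA ler_wpM2l //.
by have := addr_le_log2 R m1; lra.
Qed.
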